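(* Let $G$ be a group, $R$ a $G$-graded ring, $M$ a graded right $R$-module, and let $S=\mathrm{END}_R(M)$. (1) The following are equivalent: (i) $M$ is a self-Rickart graded right $R$-module. (ii) $S$ is a self-Rickart graded right $S$-module and for every $f\in S$, $\mathrm{Ker}(f)$ is $M$-cyclic. (iii) $S$ is a self-Rickart graded right $S$-module and for every $f\in S$, $\mathrm{Ker}(f)\in \mathrm{Stat}(\mathrm{HOM}_R(M,-))$. (2) The following are equivalent: (i) $M$ is a dual self-Rickart graded right $R$-module. (ii) $S$ is a self-Rickart graded left $S$-module and for every $f\in S$, $\mathrm{Coker}(f)$ is $M$-cocyclic. (iii) $S$ is a self-Rickart graded left $S$-module and for every $f\in S$, $\mathrm{Coker}(f)\in \mathrm{Refl}(\mathrm{HOM}_R(-,M))$.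
   Context: A ring $R$ is $G$-graded if $R=\bigoplus_{\sigma\in G}R_\sigma$ with additive subgroups $R_\sigma$ and $R_\sigma R_\tau\subseteq R_{\sigma\tau}$. A graded right $R$-module is a (unital) right $R$-module $M=\bigoplus_{\sigma\in G}M_\sigma$ with additive subgroups $M_\sigma$ and $M_\sigma R_\lambda\subseteq M_{\sigma\lambda}$. $\mathrm{gr}(R)$ is the (Grothendieck) category of graded right $R$-modules, with morphisms the $R$-homomorphisms $f:M\to N$ such that $f(M_\sigma)\subseteq N_\sigma$ for all $\sigma\in G$. For $M,N\in\mathrm{gr}(R)$, $\mathrm{HOM}_R(M,N)$ is the $G$-graded abelian group whose $\sigma$-th homogeneous component is $\mathrm{HOM}_R(M,N)_\sigma=\{f\in\mathrm{Hom}_R(M,N)\mid f(M_\lambda)\subseteq N_{\sigma\lambda}\text{ for all }\lambda\in G\}$. $S=\mathrm{END}_R(M)=\mathrm{HOM}_R(M,M)$ is a $G$-graded ring and $M$ is a graded $(S,R)$-bimodule. A graded module $X$ is self-Rickart (resp. dual self-Rickart) if it is so as an object of the category of graded modules: for every endomorphism $f$ of $X$ in that category, $\mathrm{Ker}(f)$ (resp. $\mathrm{Im}(f)$) is a direct summand of $X$ in that category. This is applied to $M$ in $\mathrm{gr}(R)$, and to $S$ in the category $\mathrm{gr}(S)$ of graded right, or the category $\mathrm{gr}(S^{\mathrm{op}})$ of graded left, $S$-modules. An object $X$ is $M$-cyclic (resp. $M$-cocyclic) if there is an epimorphism $M\to X$ (resp. a monomorphism $X\to M$). The functor $-\otimes_S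 M:\mathrm{gr}(S)\to\mathrm{gr}(R)$, where $(N\otimes_S M)_\tau=\{\sum_{\sigma\lambda=\tau}n_\sigma\otimes m_\lambda\mid n_\sigma\in N_\sigma, m_\lambda\in M_\lambda\}$, is left adjoint to $\mathrm{HOM}_R(M,-):\mathrm{gr}(R)\to\mathrm{gr}(S)$; $\mathrm{Stat}(\mathrm{HOM}_R(M,-))$ is the full subcategory of $\mathrm{gr}(R)$ of those $X$ for which the counit $\mathrm{HOM}_R(M,X)\otimes_S M\to X$ is an isomorphism. The contravariant functors $\mathrm{HOM}_R(-,M):\mathrm{gr}(R)\to\mathrm{gr}(S^{\mathrm{op}})$ and $\mathrm{HOM}_S(-,M):\mathrm{gr}(S^{\mathrm{op}})\to\mathrm{gr}(R)$ form a right adjoint pair; $\mathrm{Refl}(\mathrm{HOM}_R(-,M))$ is the full subcategory of $\mathrm{gr}(R)$ of those $X$ for which the canonical (evaluation) map $X\to\mathrm{HOM}_S(\mathrm{HOM}_R(X,M),M)$ is an isomorphism.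
   Formalization: ''For every f in S'' is read as f in S of degree 1_G, i.e. an endomorphism of M in gr(R); otherwise Ker(f) need not be graded, and for homogeneous f the claim fails: G=Z, R=M=k[x]/(x^2), deg x=1, f=x: M is self-Rickart but Ker(x) is not M-cyclic. *)

(* Defs.v *)
From HB Require Import structures.
From mathcomp Require Import all_boot all_algebra.
From mathcomp Require Import boolp classical_sets functions.
From mathcomp Require Import freeg.

Set Implicit Arguments.
Unset Strict Implicit.
Unset Printing Implicit Defensive.

Import GRing.Theory.

Local Open Scope classical_set_scope.
Local Open Scope ring_scope.

Definition subgroup (V : zmodType) (A : set V) : Prop :=
  A 0 /\ forall x y, A x -> A y -> A (x - y).

Section Grading.
Context (G : groupType) (V : zmodType) (V_ : G -> set V).

Definition decomposition (x : V) (s : seq G) (c : G -> V) : Prop :=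
  [/\ uniq s, forall i, V_ i (c i) & x = \sum_(i <- s) c i].

Definition homogeneous_sums : set V := [set x | exists s c, decomposition x s c].

Definition independent : Prop :=
  forall s c, decomposition 0 s c -> forall i, i \in s -> c i = 0.

Definition grading : Prop :=
  [/\ forall s, subgroup (V_ s), forall x, homogeneous_sums x & independent].

End Grading.

Section SubgroupTheory.
Context (V : zmodType) (A : set V) (hA : subgroup A).

Lemma subgroup0 : A 0. Proof. by case: hA. Qed.

Lemma subgroupB x y : A x -> A y -> A (x - y).
Proof. by case: hA => _; apply. Qed.

Lemma subgroupN x : A x -> A (- x).
Proof. by move=> Ax; rewrite -sub0r; apply: subgroupB (subgroup0) Ax. Qed.

Lemma subgroupD x y : A x -> A y -> A (x + y).
Proof. by move=> Ax Ay; rewrite -[y]opprK; apply: subgroupB Ax (subgroupN Ay). Qed.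

Lemma subgroup_sum (I : eqType) (s : seq I) (F : I -> V) :
  (forall i, i \in s -> A (F i)) -> A (\sum_(i <- s) F i).
Proof.
move=> AF; rewrite big_seq; elim/big_ind: _ => //.
- exact: subgroup0.
- exact: subgroupD.
Qed.

End SubgroupTheory.

Lemma sum_extend (I : eqType) (V : nmodType) (r s : seq I) (d : I -> V) :
  uniq r -> uniq s -> {subset r <= s} -> (forall i, i \notin r -> d i = 0) ->
  \sum_(i <- s) d i = \sum_(i <- r) d i.
Proof.
move=> ur us rs d0; rewrite (bigID (mem r)) /= [X in _ + X]big1 // addr0.
rewrite -big_filter; apply: perm_big.
apply: uniq_perm => //; first by rewrite filter_uniq.
move=> j; rewrite mem_filter; case: (boolP (j \in r)) => //= jr.
exact: rs.
Qed.

Section GradingTheory.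
Context (G : groupType) (V : zmodType) (V_ : G -> set V).
Hypothesis subV : forall s, subgroup (V_ s).

Lemma homogeneous_sumsW s x : V_ s x -> homogeneous_sums V_ x.
Proof.
move=> Vx; exists [:: s], (fun i => if i == s then x else 0); split => //.
- by move=> i; case: eqP => [->//|_]; apply: subgroup0.
- by rewrite big_seq1 eqxx.
Qed.

Lemma homogeneous_sums_subgroup : subgroup (homogeneous_sums V_).
Proof.
split=> [|x y [s [c [us Vc ->]]] [t [d [ut Vd ->]]]].
  by exists [::], (fun=> 0); split => //= [i|]; [exact: subgroup0|rewrite big_nil].
pose c' i := (if i \in s then c i else 0) - (if i \in t then d i else 0).
exists (undup (s ++ t)), c'; split; first exact: undup_uniq.
  by move=> i; apply: subgroupB => //; case: ifP => // _; apply: subgroup0.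
have E (r : seq G) (e : G -> V) : uniq r -> {subset r <= s ++ t} ->
    \sum_(i <- undup (s ++ t)) (if i \in r then e i else 0) = \sum_(i <- r) e i.
  move=> ur rst; rewrite (@sum_extend _ _ r) ?undup_uniq //.
  - by rewrite big_seq [RHS]big_seq; apply: eq_bigr => i ->.
  - by move=> i /rst; rewrite mem_undup.
  - by move=> i /negbTE->.
rewrite sumrB !E // => i ii; rewrite mem_cat ii ?orbT //.
Qed.

Lemma homogeneous_sums_ind (P : V -> Prop) :
  P 0 -> (forall x y, P x -> P y -> P (x + y)) ->
  (forall s x, V_ s x -> P x) -> forall x, homogeneous_sums V_ x -> P x.
Proof.
move=> P0 PD PV x [s [c [_ Vc ->]]]; elim/big_ind: _ => // i _.
exact: PV (Vc i).
Qed.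

Lemma independent_proj (p : G -> V -> V) :
  (forall s x y, p s (x + y) = p s x + p s y) ->
  (forall s x, V_ s x -> p s x = x) ->
  (forall s t x, V_ t x -> s <> t -> p s x = 0) -> independent V_.
Proof.
move=> pD pV pV' s c [us Vc E0] i si.
have p0 : p i 0 = 0 by apply: (addrI (p i 0)); rewrite -pD !addr0.
have := p0; rewrite E0 (big_morph _ (pD i) p0) (bigD1_seq i) //= pV //.
by rewrite big1 ?addr0 // => j /eqP ji; apply: pV' (Vc j) _ => ij; apply: ji.
Qed.

End GradingTheory.

Section Component.
Context (G : groupType) (V : zmodType) (V_ : G -> set V) (gV : grading V_).

Let subV : forall s, subgroup (V_ s). Proof. by case: gV. Qed.

Fact component_subproof x : exists c : G -> V, exists s : seq G,
  decomposition V_ x s c /\ forall i, i \notin s -> c i = 0.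
Proof.
have [_ /(_ x) [s [c [us Vc E]]] _] := gV.
exists (fun i => if i \in s then c i else 0), s; split; last first.
  by move=> i /negbTE->.
split=> // [i|]; first by case: ifP => // _; apply: subgroup0.
by rewrite E big_seq [RHS]big_seq; apply: eq_bigr => i ->.
Qed.

Definition component (s : G) (x : V) : V := projT1 (cid (component_subproof x)) s.

Lemma componentP x : exists s : seq G,
  decomposition V_ x s (component^~ x) /\ forall i, i \notin s -> component i x = 0.
Proof. by rewrite /component; case: cid. Qed.

Lemma component_in s x : V_ s (component s x).
Proof. by have [t [[_ + _] _]] := componentP x; apply. Qed.

Lemma component_uniq x (r : seq G) (c : G -> V) :
  decomposition V_ x r c -> (forall i, i \notin r -> c i = 0) ->
  forall i, component i x = c i.
Proof.
move=> [ur Vc E] c0 i; have [s [[us _ Ex] s0]] := componentP x.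
have [_ _ ind] := gV.
apply/eqP; rewrite -subr_eq0; apply/eqP.
have [isr|] := boolP (i \in undup (s ++ r)); last first.
  rewrite mem_undup mem_cat negb_or => /andP[/s0-> /c0->].
  by rewrite subrr.
apply: (ind (undup (s ++ r)) (fun i => component i x - c i)) => //; split.
- exact: undup_uniq.
- by move=> j; apply: subgroupB => //; apply: component_in.
- rewrite sumrB (@sum_extend _ _ s (undup (s ++ r))) ?undup_uniq //
    ?(@sum_extend _ _ r (undup (s ++ r))) ?undup_uniq //.
  + by rewrite -Ex -E subrr.
  + by move=> j jr; rewrite mem_undup mem_cat jr orbT.
  + by move=> j jr; rewrite mem_undup mem_cat jr.
Qed.

Lemma component_id s x : V_ s x -> component s x = x.
Proof.
move=> Vx; rewrite (@component_uniq x [:: s] (fun i => if i == s then x else 0)).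
- by rewrite eqxx.
- split=> // [i|]; last by rewrite big_seq1 eqxx.
  by case: eqP => [->//|_]; apply: subgroup0.
- by move=> i; rewrite inE => /negbTE->.
Qed.

Lemma component_out s t x : V_ t x -> s <> t -> component s x = 0.
Proof.
move=> Vx /eqP/negbTE st.
rewrite (@component_uniq x [:: t] (fun i => if i == t then x else 0)) ?st //.
- split=> // [i|]; last by rewrite big_seq1 eqxx.
  by case: eqP => [->//|_]; apply: subgroup0.
- by move=> i; rewrite inE => /negbTE->.
Qed.

Lemma componentB s x y : component s (x - y) = component s x - component s y.
Proof.
have [t [[ut _ Ex] t0]] := componentP x; have [r [[ur _ Ey] r0]] := componentP y.
rewrite (@component_uniq (x - y) (undup (t ++ r))
  (fun i => component i x - component i y)) //.
- split; first exact: undup_uniq.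
  + by move=> i; apply: subgroupB => //; apply: component_in.
  + rewrite sumrB (@sum_extend _ _ t (undup (t ++ r))) ?undup_uniq //
      ?(@sum_extend _ _ r (undup (t ++ r))) ?undup_uniq //.
    * by rewrite -Ex -Ey.
    * by move=> j jr; rewrite mem_undup mem_cat jr orbT.
    * by move=> j jr; rewrite mem_undup mem_cat jr.
- move=> i; rewrite mem_undup mem_cat negb_or => /andP[/t0-> /r0->].
  by rewrite subrr.
Qed.

Lemma componentD s x y : component s (x + y) = component s x + component s y.
Proof.
have c0 : component s 0 = 0.
  by rewrite -[X in component _ X](subrr 0) componentB subrr.
have cN : component s (- y) = - component s y.
  by rewrite -sub0r componentB c0 sub0r.
by rewrite -[y in LHS]opprK componentB cN opprK.
Qed.

End Component.

Section ZQuotient.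
Context (V : zmodType) (A : set V) (hA : subgroup A).

Definition zquot_equiv (x y : V) : bool := `[< A (x - y) >].

Fact zquot_equiv_class : equiv_class_of zquot_equiv.
Proof.
split=> [x|x y|y x z].
- by apply/asboolP; rewrite subrr; apply: subgroup0.
- by apply/asboolP/asboolP => /(subgroupN hA); rewrite opprB.
- move=> /asboolP Axy /asboolP Ayz; apply/asboolP.
  by rewrite -(subrKA y); apply: subgroupD.
Qed.

Canonical zquot_equivRel := EquivRelPack zquot_equiv_class.
Canonical zquot_encModRel := defaultEncModRel zquot_equiv.

Definition zquot := {eq_quot zquot_equivRel}%qT.

HB.instance Definition _ := Choice.on zquot.
HB.instance Definition _ := EqQuotient.on zquot.

Definition zpi (x : V) : zquot := \pi_zquot%qT x.

Lemma zpi_eq x y : zpi x = zpi y <-> A (x - y).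
Proof.
split=> [/eqP|Axy]; first by rewrite eqmodE => /asboolP.
by apply/eqP; rewrite eqmodE; apply/asboolP.
Qed.

Lemma zquotW (P : zquot -> Prop) : (forall x, P (zpi x)) -> forall q, P q.
Proof. by move=> Ppi q; rewrite -[q]reprK; apply: Ppi. Qed.

Definition zquot_lift (W : Type) (f : V -> W) (q : zquot) : W := f (repr q).

Lemma zquot_liftE W (f : V -> W) :
  (forall x y, A (x - y) -> f x = f y) -> forall x, zquot_lift f (zpi x) = f x.
Proof. by move=> fA x; apply: fA; apply/zpi_eq; rewrite /zpi reprK. Qed.

Definition zquot_add (p q : zquot) := zpi (repr p + repr q).
Definition zquot_opp (p : zquot) := zpi (- repr p).

Lemma zpiD_subproof x y : zquot_add (zpi x) (zpi y) = zpi (x + y).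
Proof.
apply/zpi_eq; rewrite opprD addrACA.
by apply: subgroupD => //; apply/zpi_eq; rewrite /zpi reprK.
Qed.

Lemma zpiN_subproof x : zquot_opp (zpi x) = zpi (- x).
Proof.
apply/zpi_eq; rewrite -opprD; apply: subgroupN => //.
by apply/zpi_eq; rewrite /zpi reprK.
Qed.

Fact zquot_addA : associative zquot_add.
Proof.
by elim/zquotW=> x; elim/zquotW=> y; elim/zquotW=> z; rewrite !zpiD_subproof addrA.
Qed.
Fact zquot_addC : commutative zquot_add.
Proof. by elim/zquotW=> x; elim/zquotW=> y; rewrite !zpiD_subproof addrC. Qed.
Fact zquot_add0 : left_id (zpi 0) zquot_add.
Proof. by elim/zquotW=> x; rewrite !zpiD_subproof add0r. Qed.
Fact zquot_addN : left_inverse (zpi 0) zquot_opp zquot_add.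
Proof. by elim/zquotW=> x; rewrite zpiN_subproof !zpiD_subproof addNr. Qed.

HB.instance Definition _ :=
  GRing.isZmodule.Build zquot zquot_addA zquot_addC zquot_add0 zquot_addN.

Lemma zpiD x y : zpi (x + y) = zpi x + zpi y.
Proof. by rewrite -zpiD_subproof. Qed.
Lemma zpiN x : zpi (- x) = - zpi x.
Proof. by rewrite -zpiN_subproof. Qed.
Lemma zpi0 : zpi 0 = 0. Proof. by []. Qed.

Lemma zpi_eq0 x : zpi x = 0 <-> A x.
Proof. by rewrite -zpi0 zpi_eq subr0. Qed.

End ZQuotient.

Record grRing (G : groupType) := GrRing {
  grring_sort :> pzRingType;
  rhomog : G -> set grring_sort;
  grringP : grading rhomog;
  rhomogM : forall s t x y, rhomog s x -> rhomog t y -> rhomog (s * t)%g (x * y)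
}.

(* A module with a grading; right R-modules are modules over the converse ring
   R^c, so that x r is written (r : R^c) *: x. *)
Record gmod (G : groupType) (A : pzRingType) := Gmod {
  gmod_sort :> lmodType A;
  homog : G -> set gmod_sort;
  homogP : grading homog
}.

Record rgrmod (G : groupType) (R : grRing G) := Rgrmod {
  rgrmod_gmod :> gmod G R^c;
  homogZr : forall s t (x : rgrmod_gmod) (r : R),
    homog s x -> rhomog t r -> homog (s * t)%g ((r : R^c) *: x)
}.

Record lgrmod (G : groupType) (R : grRing G) := Lgrmod {
  lgrmod_gmod :> gmod G R;
  homogZl : forall s t (r : R) (x : lgrmod_gmod),
    rhomog s r -> homog t x -> homog (s * t)%g (r *: x)
}.

Section GmodTheory.
Context (G : groupType) (A : pzRingType) (X : gmod G A).

Lemma homog_subgroup s : subgroup (@homog _ _ X s).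
Proof. by case: (homogP X). Qed.

Lemma homog_sums (x : X) : homogeneous_sums (@homog _ _ X) x.
Proof. by case: (homogP X). Qed.

Lemma homog_independent : independent (@homog _ _ X).
Proof. by case: (homogP X). Qed.

End GmodTheory.

Record ghom (G : groupType) (A : pzRingType) (X Y : gmod G A) := Ghom {
  ghom_linear :> {linear X -> Y};
  ghomP : forall s x, homog s x -> homog s (ghom_linear x)
}.

Definition is_giso (G : groupType) (A : pzRingType) (X Y : gmod G A)
    (f : ghom X Y) : Prop :=
  exists g : ghom Y X, cancel f g /\ cancel g f.

Definition is_epi (G : groupType) (R : grRing G) (X Y : rgrmod R)
    (f : ghom X Y) : Prop :=
  forall (Z : rgrmod R) (g h : ghom Y Z), g \o f =1 h \o f -> g =1 h.

Definition is_mono (G : groupType) (R : grRing G) (X Y : rgrmod R)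
    (f : ghom X Y) : Prop :=
  forall (Z : rgrmod R) (g h : ghom Z X), f \o g =1 f \o h -> g =1 h.

Definition cyclic_over (G : groupType) (R : grRing G) (M X : rgrmod R) : Prop :=
  exists f : ghom M X, is_epi f.

Definition cocyclic_over (G : groupType) (R : grRing G) (M X : rgrmod R) : Prop :=
  exists f : ghom X M, is_mono f.

Section Submodules.
Context (G : groupType) (A : pzRingType) (X : gmod G A).

Definition gsubmod (K : set X) : Prop :=
  [/\ K 0, forall a x y, K x -> K y -> K (a *: x + y) &
      forall x, K x -> homogeneous_sums (fun s => [set y | homog s y /\ K y]) x].

Definition direct_summand (K : set X) : Prop :=
  gsubmod K /\ exists L : set X,
    [/\ gsubmod L, forall x, exists2 k, K k & exists2 l, L l & x = k + l &
        forall x, K x -> L x -> x = 0].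

Definition gker (Y : gmod G A) (f : ghom X Y) : set X := [set x | f x = 0].

Definition gim (Y : gmod G A) (f : ghom Y X) : set X := range f.

End Submodules.

Definition self_rickart (G : groupType) (A : pzRingType) (X : gmod G A) : Prop :=
  forall f : ghom X X, direct_summand (gker f).

Definition dual_self_rickart (G : groupType) (A : pzRingType) (X : gmod G A) : Prop :=
  forall f : ghom X X, direct_summand (gim f).

Section SubmodulesTheory.
Context (G : groupType) (A : pzRingType).

Lemma gsubmod_subgroup (X : gmod G A) (K : set X) : gsubmod K -> subgroup K.
Proof.
case=> K0 KL _; split=> // x y Kx Ky.
by rewrite addrC -scaleN1r; apply: KL.
Qed.

Lemma gsubmodZ (X : gmod G A) (K : set X) : gsubmod K -> forall a x, K x -> K (a *: x).
Proof. by case=> K0 KL _ a x Kx; rewrite -[_ *: _]addr0; apply: KL. Qed.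

Lemma gsubmod_homog (X : gmod G A) (K : set X) : gsubmod K ->
  forall s, subgroup (fun y : X => homog s y /\ K y).
Proof.
move=> gK s; have sK := gsubmod_subgroup gK; have sX := homog_subgroup X s.
split=> [|x y [? ?] [? ?]]; split.
- exact: subgroup0.
- exact: subgroup0.
- exact: subgroupB.
- exact: subgroupB.
Qed.

Lemma gsubmod_component (X : gmod G A) (K : set X) : gsubmod K ->
  forall s x, K x -> K (component (homogP X) s x).
Proof.
move=> gK s x Kx; have sK := gsubmod_subgroup gK.
have [_ _ /(_ x Kx)] := gK; elim/homogeneous_sums_ind.
- suff -> : component (homogP X) s 0 = 0 by exact: subgroup0.
  by rewrite -[X in component _ _ X](subrr 0) componentB subrr.
- by move=> y z Ky Kz; rewrite componentD; apply: subgroupD.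
- move=> t y [Xy Ky]; have [->|/eqP st] := eqVneq s t.
    by rewrite component_id.
  by rewrite (component_out _ Xy st); apply: subgroup0.
Qed.

Lemma gker_gsubmod (X Y : gmod G A) (f : ghom X Y) : gsubmod (gker f).
Proof.
split=> [|a x y fx fy|x fx]; rewrite /gker /=.
- exact: raddf0.
- by rewrite linearP fx fy scaler0 addr0.
have [s [c [us Xc E]]] := homog_sums x.
have Kc i : i \in s -> f (c i) = 0.
  apply: (homog_independent (s := s) (c := fun i => f (c i))); split=> //.
    by move=> j; apply: ghomP.
  by rewrite -raddf_sum -E.
exists s, (fun i => if i \in s then c i else 0); split=> //.
  move=> i; case: ifP => [si|_]; first by split=> //; apply: Kc.
  by split; [apply: (subgroup0 (homog_subgroup X i))|exact: raddf0].
by rewrite E big_seq [RHS]big_seq; apply: eq_bigr => i ->.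
Qed.

Lemma gim_gsubmod (X Y : gmod G A) (f : ghom Y X) : gsubmod (gim f).
Proof.
split=> [|a _ _ [x _ <-] [y _ <-]|_ [x _ <-]].
- by exists 0 => //; exact: raddf0.
- by exists (a *: x + y); rewrite ?linearP.
have [s [c [us Xc E]]] := homog_sums x.
exists s, (fun i => f (c i)); split=> // [i|]; last by rewrite E raddf_sum.
by split; [apply: ghomP|exists (c i)].
Qed.

End SubmodulesTheory.

Section SubObject.
Context (G : groupType) (A : pzRingType) (X : gmod G A) (K : set X) (gK : gsubmod K).

Definition gsub_pred : {pred X} := fun x => `[< K x >].

Fact gsub_pred_closed : submod_closed gsub_pred.
Proof.
have [K0 KL _] := gK; split; first exact/asboolP.
by move=> a x y /asboolP Kx /asboolP Ky; apply/asboolP; apply: KL.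
Qed.

Definition gsub_type (_ : gsubmod K) : Type := {x : X | x \in gsub_pred}.
Local Notation T := (gsub_type gK).

HB.instance Definition _ := [isSub of T for @sval _ _].
HB.instance Definition _ := [Choice of T by <:].
HB.instance Definition _ := GRing.SubChoice_isSubLmodule.Build A X gsub_pred T
  gsub_pred_closed.

Definition gsub_homog (s : G) : set T := [set x | homog s (val x)].

Fact gsub_grading : grading gsub_homog.
Proof.
have sX := homog_subgroup X; split.
- move=> s; split=> [|x y]; rewrite /gsub_homog /= ?raddf0 ?raddfB.
    exact: subgroup0.
  exact: subgroupB.
- case=> x xK; have [_ _ /(_ x)] := gK; case; first exact/asboolP.
  move=> s [c [us Kc E]].
  exists s, (fun i => exist _ (c i) (asboolT (proj2 (Kc i))) : T); split=> //.
    by move=> i; case: (Kc i).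
  by apply: val_inj; rewrite raddf_sum.
- move=> s c [us Kc E] i si; apply: val_inj; rewrite raddf0.
  apply: (homog_independent (s := s) (c := fun i => val (c i))) => //.
  by split=> //; rewrite -raddf_sum -E raddf0.
Qed.

Definition gsub : gmod G A := Gmod gsub_grading.

End SubObject.

Section GQuotient.
Context (G : groupType) (A : pzRingType) (X : gmod G A) (K : set X) (gK : gsubmod K).

Definition gquot_type : Type := zquot (gsubmod_subgroup gK).
HB.instance Definition _ := GRing.Zmodule.on gquot_type.

Definition gquot_pi (x : X) : gquot_type := zpi (gsubmod_subgroup gK) x.

Definition gquot_scale (a : A) (q : gquot_type) : gquot_type :=
  zquot_lift (fun x => gquot_pi (a *: x)) q.

Lemma gquot_scaleE a x : gquot_scale a (gquot_pi x) = gquot_pi (a *: x).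
Proof.
apply: (zquot_liftE (gsubmod_subgroup gK) (f := fun x => gquot_pi (a *: x))) => y z Kyz.
by apply/zpi_eq; rewrite -scalerBr; apply: gsubmodZ.
Qed.

Lemma gquotW (P : gquot_type -> Prop) : (forall x, P (gquot_pi x)) -> forall q, P q.
Proof. exact: zquotW. Qed.

Lemma gquot_piD x y : gquot_pi (x + y) = gquot_pi x + gquot_pi y.
Proof. exact: zpiD. Qed.

Lemma gquot_pi_eq0 x : gquot_pi x = 0 <-> K x.
Proof. exact: zpi_eq0. Qed.

Fact gquot_scaleA a b q : gquot_scale a (gquot_scale b q) = gquot_scale (a * b) q.
Proof. by elim/gquotW: q => x; rewrite !gquot_scaleE scalerA. Qed.
Fact gquot_scale1 : left_id 1 gquot_scale.
Proof. by elim/gquotW=> x; rewrite !gquot_scaleE scale1r. Qed.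
Fact gquot_scaleDr : right_distributive gquot_scale +%R.
Proof.
move=> a; elim/gquotW=> x; elim/gquotW=> y.
by rewrite -gquot_piD !gquot_scaleE scalerDr gquot_piD.
Qed.
Fact gquot_scaleDl q : {morph gquot_scale^~ q : a b / a + b}.
Proof.
by move=> a b; elim/gquotW: q => x; rewrite !gquot_scaleE scalerDl gquot_piD.
Qed.

HB.instance Definition _ := GRing.Zmodule_isLmodule.Build A gquot_type
  gquot_scaleA gquot_scale1 gquot_scaleDr gquot_scaleDl.

Fact gquot_pi_linear : linear gquot_pi.
Proof. by move=> a x y; rewrite gquot_piD -gquot_scaleE. Qed.
HB.instance Definition _ := GRing.isLinear.Build A X gquot_type _ gquot_pi
  gquot_pi_linear.

Definition gquot_homog (s : G) : set gquot_type := gquot_pi @` homog s.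

Fact gquot_grading : grading gquot_homog.
Proof.
have sX := homog_subgroup X; split.
- move=> s; split=> [|_ _ [x Xx <-] [y Xy <-]].
    by exists 0; [exact: subgroup0|exact: raddf0].
  by exists (x - y); [exact: subgroupB|exact: raddfB].
- elim/gquotW=> x; have [s [c [us Xc E]]] := homog_sums x.
  exists s, (fun i => gquot_pi (c i)); split=> // [i|]; first by exists (c i).
  by rewrite E raddf_sum.
- pose p s (q : gquot_type) : gquot_type :=
    zquot_lift (fun x => gquot_pi (component (homogP X) s x)) q.
  have pE s x : p s (gquot_pi x) = gquot_pi (component (homogP X) s x).
    apply: (zquot_liftE (gsubmod_subgroup gK)
      (f := fun x => gquot_pi (component (homogP X) s x))).
    move=> y z Kyz; apply/zpi_eq; rewrite -componentB.
    exact: gsubmod_component.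
  apply: (independent_proj (p := p)).
  + move=> s; elim/gquotW=> x; elim/gquotW=> y.
    by rewrite -gquot_piD !pE componentD gquot_piD.
  + by move=> s _ [x Xx <-]; rewrite pE component_id.
  + move=> s t _ [x Xx <-] st; rewrite pE (component_out _ Xx st).
    exact: raddf0.
Qed.

Definition gquot : gmod G A := Gmod gquot_grading.

End GQuotient.

Section KerCoker.
Context (G : groupType) (R : grRing G).

Fact rgsub_subproof (X : rgrmod R) (K : set X) (gK : gsubmod K) s t
  (x : gsub gK) (r : R) :
  homog s x -> rhomog t r -> homog (s * t)%g ((r : R^c) *: x).
Proof. by move=> Xx Rr; apply: (homogZr (x := val (x : gsub_type gK)) Xx Rr). Qed.

Definition rgsub (X : rgrmod R) (K : set X) (gK : gsubmod K) : rgrmod R :=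
  Rgrmod (@rgsub_subproof X K gK).

Fact rgquot_subproof (X : rgrmod R) (K : set X) (gK : gsubmod K) s t
  (x : gquot gK) (r : R) :
  homog s x -> rhomog t r -> homog (s * t)%g ((r : R^c) *: x).
Proof.
move=> [y Xy <-] Rr; exists ((r : R^c) *: y); first exact: homogZr.
by rewrite linearZ.
Qed.

Definition rgquot (X : rgrmod R) (K : set X) (gK : gsubmod K) : rgrmod R :=
  Rgrmod (@rgquot_subproof X K gK).

Definition Ker (X Y : rgrmod R) (f : ghom X Y) : rgrmod R := rgsub (gker_gsubmod f).

Definition Coker (X Y : rgrmod R) (f : ghom X Y) : rgrmod R := rgquot (gim_gsubmod f).

End KerCoker.

Section Regular.
Context (G : groupType) (R : grRing G).

Definition rregular_gmod : gmod G R^c :=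
  @Gmod G R^c (R^c)^o (@rhomog G R) (grringP R).

Fact rregular_subproof s t (x : rregular_gmod) (r : R) :
  homog s x -> rhomog t r -> homog (s * t)%g ((r : R^c) *: x).
Proof. exact: rhomogM. Qed.

Definition rregular : rgrmod R := Rgrmod rregular_subproof.

Definition lregular_gmod : gmod G R := @Gmod G R R^o (@rhomog G R) (grringP R).

Fact lregular_subproof s t (r : R) (x : lregular_gmod) :
  rhomog s r -> homog t x -> homog (s * t)%g (r *: x).
Proof. exact: rhomogM. Qed.

Definition lregular : lgrmod R := Lgrmod lregular_subproof.

End Regular.

Section HomSum.
Context (G : groupType) (A : pzRingType) (op : G -> G -> G) (X Y : gmod G A).

Definition hom_homog (s : G) : set (X -> Y) :=
  [set f | linear f /\ forall t x, homog t x -> homog (op s t) (f x)].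

Lemma hom_homog_subgroup s : subgroup (hom_homog s).
Proof.
split=> [|f g [lf hf] [lg hg]].
- split=> [a x y|t x _]; first by rewrite scaler0 addr0.
  exact: (subgroup0 (homog_subgroup Y _)).
- split=> [a x y|t x Xx].
  + by rewrite !fctE lf lg scalerBr opprD addrACA.
  + by apply: (subgroupB (homog_subgroup Y _)); [apply: hf|apply: hg].
Qed.

Definition hom_pred : {pred X -> Y} := fun f => `[< homogeneous_sums hom_homog f >].

Fact hom_pred_closed : zmod_closed hom_pred.
Proof.
have hs := homogeneous_sums_subgroup hom_homog_subgroup; split.
- by apply/asboolP; apply: subgroup0.
- by move=> f g /asboolP hf /asboolP hg; apply/asboolP; apply: subgroupB.
Qed.

(* Finite sums of homogeneous A-linear maps X -> Y, where a homogeneous map of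
   degree s sends X_t to Y_(op s t). *)
Definition homsum : Type := {f : X -> Y | f \in hom_pred}.

HB.instance Definition _ := [isSub of homsum for @sval _ _].
HB.instance Definition _ := [Choice of homsum by <:].
HB.instance Definition _ := GRing.SubChoice_isSubZmodule.Build (X -> Y) hom_pred
  homsum hom_pred_closed.

Definition hev (f : homsum) (x : X) : Y := val f x.

Lemma homsumP (f : homsum) : homogeneous_sums hom_homog (hev f).
Proof. exact: asboolW (valP f). Qed.

Lemma homsum_inj (f g : homsum) : hev f =1 hev g -> f = g.
Proof. by move=> fg; apply: val_inj; apply/funext. Qed.

Definition mk_homsum (f : X -> Y) (hf : homogeneous_sums hom_homog f) : homsum :=
  exist _ f (asboolT hf).

Lemma hev_linear (f : homsum) : linear (hev f).
Proof.
move: (hev f) (homsumP f) => {}f hf.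
apply: (homogeneous_sums_ind (P := fun f => linear f) _ _ _ hf)
  => [|{hf}f g|s {hf}f [//]].
- by move=> a x y; rewrite scaler0 addr0.
- by move=> lf lg a x y; rewrite !fctE lf lg scalerDr addrACA.
Qed.

Lemma hevD (f : homsum) x y : hev f (x + y) = hev f x + hev f y.
Proof. by rewrite -[x in LHS]scale1r hev_linear scale1r. Qed.

Lemma hev0 (f : homsum) : hev f 0 = 0.
Proof. by apply: (addrI (hev f 0)); rewrite -hevD !addr0. Qed.

Lemma hevZ (f : homsum) a x : hev f (a *: x) = a *: hev f x.
Proof. by rewrite -[a *: x]addr0 hev_linear hev0 addr0. Qed.

Lemma hev_sum (I : Type) (s : seq I) (F : I -> X) (f : homsum) :
  hev f (\sum_(i <- s) F i) = \sum_(i <- s) hev f (F i).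
Proof. exact: (big_morph _ (hevD f) (hev0 f)). Qed.

Lemma homsumD (f g : homsum) x : hev (f + g) x = hev f x + hev g x.
Proof. by []. Qed.

Lemma homsum_sum (I : Type) (s : seq I) (F : I -> homsum) x :
  hev (\sum_(i <- s) F i) x = \sum_(i <- s) hev (F i) x.
Proof. by elim/big_rec2: _ => // i y f _ <-. Qed.

Definition homsum_homog (s : G) : set homsum :=
  [set f | forall t x, homog t x -> homog (op s t) (hev f x)].

Lemma homsum_homog_hom s f : homsum_homog s f <-> hom_homog s (hev f).
Proof. by split=> [hf|[]//]; split=> //; apply: hev_linear. Qed.

Lemma homsum_grading : (forall t, injective (op^~ t)) -> grading homsum_homog.
Proof.
move=> op_inj; split.
- move=> s; split=> [t x _|f g hf hg t x Xx].
    exact: (subgroup0 (homog_subgroup Y _)).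
  by apply: (subgroupB (homog_subgroup Y _)); [apply: hf|apply: hg].
- move=> f; have [s [c [us hc E]]] := homsumP f.
  exists s, (fun i => mk_homsum (homogeneous_sumsW hom_homog_subgroup (hc i))).
  split=> // [i|]; first by case: (hc i).
  by apply: homsum_inj => x; rewrite E homsum_sum fct_sumE.
- move=> s c [us hc E] i si; apply: homsum_inj => x.
  pattern x; apply: (homogeneous_sums_ind _ _ _ (homog_sums x)) => {x}.
    by rewrite hev0.
    by move=> x y Ex Ey; rewrite !hevD Ex Ey.
  move=> t x Xx; have c0 : component (homogP Y) (op i t) 0 = 0.
    by rewrite component_id //; apply: (subgroup0 (homog_subgroup Y _)).
  have : component (homogP Y) (op i t) (hev (\sum_(j <- s) c j) x) = 0 by rewrite -E.
  rewrite homsum_sum (big_morph _ (componentD _ _) c0).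
  rewrite (bigD1_seq i) //= component_id; last exact: (hc i t x Xx).
  rewrite big1 ?addr0 // => j ji; apply: component_out (hc j t x Xx) _.
  by move=> /op_inj ij; rewrite ij eqxx in ji.
Qed.

End HomSum.

Arguments hom_homog {G A} op {X Y} s _.

Section RightHom.
Context (G : groupType) (R : grRing G).

Definition rHOM (X Y : rgrmod R) : Type := homsum *%g X Y.
HB.instance Definition _ X Y := GRing.Zmodule.on (rHOM X Y).

Fact rHOM_grading (X Y : rgrmod R) : grading (@homsum_homog G _ *%g X Y).
Proof. by apply: homsum_grading => t; apply: mulIg. Qed.

Fact rHOM_comp_homog (X Y Z : rgrmod R) s t (f : Y -> Z) (g : X -> Y) :
  hom_homog *%g s f -> hom_homog *%g t g ->
  hom_homog *%g (s * t)%g (f \o g).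
Proof.
move=> [lf hf] [lg hg]; split=> [a x y|u x Xx] /=; first by rewrite lg lf.
by rewrite -mulgA; apply/hf/hg.
Qed.

Fact rHOM_comp_subproof (X Y Z : rgrmod R) (f : rHOM Y Z) (g : rHOM X Y) :
  homogeneous_sums (hom_homog *%g) (hev f \o hev g).
Proof.
have hs := homogeneous_sums_subgroup (@hom_homog_subgroup G R^c *%g X Z).
have [s [c [us hc Ef]]] := homsumP f; have [t [d [ut hd Eg]]] := homsumP g.
have -> : hev f \o hev g = \sum_(i <- s) \sum_(j <- t) (c i \o d j).
  apply/funext => x; rewrite /= {1}Ef fct_sumE fct_sumE; apply: eq_bigr => i _.
  have [lc _] := hc i; pose C := GRing.isLinear.Build _ _ _ _ _ lc.
  pose c' : {linear Y -> Z} := HB.pack (c i) C.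
  by rewrite fct_sumE Eg fct_sumE -[c i]/(c' : Y -> Z) raddf_sum.
apply: subgroup_sum => // i _; apply: subgroup_sum => // j _.
apply: homogeneous_sumsW; first exact: hom_homog_subgroup.
exact: rHOM_comp_homog (hc i) (hd j).
Qed.

Definition rHOM_comp (X Y Z : rgrmod R) (f : rHOM Y Z) (g : rHOM X Y) : rHOM X Z :=
  mk_homsum (rHOM_comp_subproof f g).

Fact rHOM_id_subproof (X : rgrmod R) :
  homogeneous_sums (@hom_homog G _ *%g X X) id.
Proof.
apply: (homogeneous_sumsW (@hom_homog_subgroup _ _ _ _ _) (s := 1%g)).
by split=> // t x; rewrite mul1g.
Qed.

Definition rHOM_id (X : rgrmod R) : rHOM X X := mk_homsum (rHOM_id_subproof X).

End RightHom.

Section End_.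
Context (G : groupType) (R : grRing G) (M : rgrmod R).

Definition END : Type := rHOM M M.
HB.instance Definition _ := GRing.Zmodule.on END.

Fact END_mulA : associative (@rHOM_comp G R M M M).
Proof. by move=> f g h; apply: homsum_inj. Qed.
Fact END_mul1 : left_id (rHOM_id M) (@rHOM_comp G R M M M).
Proof. by move=> f; apply: homsum_inj. Qed.
Fact END_1mul : right_id (rHOM_id M) (@rHOM_comp G R M M M).
Proof. by move=> f; apply: homsum_inj. Qed.
Fact END_mulDl : left_distributive (@rHOM_comp G R M M M) +%R.
Proof. by move=> f g h; apply: homsum_inj. Qed.
Fact END_mulDr : right_distributive (@rHOM_comp G R M M M) +%R.
Proof. by move=> f g h; apply: homsum_inj => x; apply: hevD. Qed.

HB.instance Definition _ := GRing.Zmodule_isPzRing.Build END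
  END_mulA END_mul1 END_1mul END_mulDl END_mulDr.

Fact END_homogM s t (f g : END) :
  homsum_homog s f -> homsum_homog t g -> homsum_homog (s * t)%g (f * g).
Proof. by move=> hf hg u x Xx; rewrite -mulgA; apply/hf/hg. Qed.

Definition END_gr : grRing G := @GrRing G END _ (rHOM_grading M M) END_homogM.

(* The elements of END_R(M) of trivial degree are the endomorphisms of M in
   gr(R). *)
Fact End0_linear (f : END_gr) : linear (hev (f : END)).
Proof. exact: hev_linear. Qed.

Definition End0_fun (f : END_gr) (_ : rhomog 1%g f) : M -> M := hev (f : END).

HB.instance Definition _ f f1 := GRing.isLinear.Build _ _ _ _ (@End0_fun f f1)
  (End0_linear f).

Fact End0_deg (f : END_gr) (f1 : rhomog 1%g f) s (x : M) :
  homog s x -> homog s (End0_fun f1 x).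
Proof. by move=> Mx; rewrite -[s]mul1g; apply: f1. Qed.

Definition End0 (f : END_gr) (f1 : rhomog 1%g f) : ghom M M :=
  @Ghom G _ M M (End0_fun f1 : {linear M -> M}) (End0_deg f1).

End End_.

Section HomFrom.
Context (G : groupType) (R : grRing G) (M X : rgrmod R).
Local Notation S := (END_gr M).

(* The right action of S on HOM_R(M, X) is f s = f \o s. *)
Definition HOM_from_type : Type := rHOM M X.
HB.instance Definition _ := GRing.Zmodule.on HOM_from_type.

Definition HOM_from_scale (s : S^c) (f : HOM_from_type) : HOM_from_type :=
  rHOM_comp f (s : END M).

Fact HOM_from_scaleA a b f :
  HOM_from_scale a (HOM_from_scale b f) = HOM_from_scale (a * b) f.
Proof. exact: homsum_inj. Qed.
Fact HOM_from_scale1 : left_id 1 HOM_from_scale.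
Proof. by move=> f; apply: homsum_inj. Qed.
Fact HOM_from_scaleDr : right_distributive HOM_from_scale +%R.
Proof. by move=> a f g; apply: homsum_inj. Qed.
Fact HOM_from_scaleDl f : {morph HOM_from_scale^~ f : a b / a + b}.
Proof. by move=> a b; apply: homsum_inj => x; apply: hevD. Qed.

HB.instance Definition _ := GRing.Zmodule_isLmodule.Build S^c HOM_from_type
  HOM_from_scaleA HOM_from_scale1 HOM_from_scaleDr HOM_from_scaleDl.

Definition HOM_from_gmod : gmod G S^c :=
  @Gmod G S^c HOM_from_type _ (rHOM_grading M X).

Fact HOM_from_subproof s t (f : HOM_from_gmod) (r : S) :
  homog s f -> rhomog t r -> homog (s * t)%g ((r : S^c) *: f).
Proof. by move=> hf hr u x Xx; rewrite -mulgA; apply/hf/hr. Qed.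

Definition HOM_from : rgrmod S := Rgrmod HOM_from_subproof.

End HomFrom.

Section HomTo.
Context (G : groupType) (R : grRing G) (X M : rgrmod R).
Local Notation S := (END_gr M).

(* The left action of S on HOM_R(X, M) is s f = s \o f. *)
Definition HOM_to_type : Type := rHOM X M.
HB.instance Definition _ := GRing.Zmodule.on HOM_to_type.

Definition HOM_to_scale (s : S) (f : HOM_to_type) : HOM_to_type :=
  rHOM_comp (s : END M) f.

Fact HOM_to_scaleA a b f : HOM_to_scale a (HOM_to_scale b f) = HOM_to_scale (a * b) f.
Proof. exact: homsum_inj. Qed.
Fact HOM_to_scale1 : left_id 1 HOM_to_scale.
Proof. by move=> f; apply: homsum_inj. Qed.
Fact HOM_to_scaleDr : right_distributive HOM_to_scale +%R.
Proof. by move=> a f g; apply: homsum_inj => x; apply: hevD. Qed.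
Fact HOM_to_scaleDl f : {morph HOM_to_scale^~ f : a b / a + b}.
Proof. by move=> a b; apply: homsum_inj. Qed.

HB.instance Definition _ := GRing.Zmodule_isLmodule.Build S HOM_to_type
  HOM_to_scaleA HOM_to_scale1 HOM_to_scaleDr HOM_to_scaleDl.

Definition HOM_to_gmod : gmod G S := @Gmod G S HOM_to_type _ (rHOM_grading X M).

Fact HOM_to_subproof s t (r : S) (f : HOM_to_gmod) :
  rhomog s r -> homog t f -> homog (s * t)%g (r *: f).
Proof. by move=> hr hf u x Xx; rewrite -mulgA; apply/hr/hf. Qed.

Definition HOM_to : lgrmod S := Lgrmod HOM_to_subproof.

End HomTo.

Section LeftModule.
Context (G : groupType) (R : grRing G) (M : rgrmod R).
Local Notation S := (END_gr M).

(* A copy of M that carries its left S-module structure s m = s(m), instead of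
   the right R-module structure. *)
Definition lmod_type : Type := M.
HB.instance Definition _ := GRing.Zmodule.on lmod_type.

Definition lmod_scale (s : S) (m : lmod_type) : lmod_type := hev (s : END M) m.

Fact lmod_scaleA a b m : lmod_scale a (lmod_scale b m) = lmod_scale (a * b) m.
Proof. by []. Qed.
Fact lmod_scale1 : left_id 1 lmod_scale.
Proof. by []. Qed.
Fact lmod_scaleDr : right_distributive lmod_scale +%R.
Proof. by move=> a x y; apply: hevD. Qed.
Fact lmod_scaleDl m : {morph lmod_scale^~ m : a b / a + b}.
Proof. by []. Qed.

HB.instance Definition _ := GRing.Zmodule_isLmodule.Build S lmod_type
  lmod_scaleA lmod_scale1 lmod_scaleDr lmod_scaleDl.

Definition lmod_gmod : gmod G S := @Gmod G S lmod_type (@homog _ _ M) (homogP M).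

Fact lmod_subproof s t (r : S) (x : lmod_gmod) :
  rhomog s r -> homog t x -> homog (s * t)%g (r *: x).
Proof. by move=> hr Mx; apply: hr. Qed.

Definition left_mod : lgrmod S := Lgrmod lmod_subproof.

End LeftModule.

Section LeftHom.
Context (G : groupType) (R : grRing G) (M : rgrmod R) (N : lgrmod (END_gr M)).
Local Notation S := (END_gr M).

(* For left modules, the homogeneous maps of degree s send N_t to M_(t s); this
   is the convention for which the action (f r)(n) = f(n) r of R on HOM_S(N, M)
   and the evaluation map below are graded. *)
Definition lHOM_type : Type := homsum (fun s t => t * s)%g N (left_mod M).
HB.instance Definition _ := GRing.Zmodule.on lHOM_type.

Definition rscale (r : R) (f : N -> left_mod M) : N -> left_mod M :=
  fun n => ((r : R^c) *: (f n : M) : M).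

Fact rscale_homog s t (r : R) (f : N -> left_mod M) :
  hom_homog (fun s t => t * s)%g s f -> rhomog t r ->
  hom_homog (fun s t => t * s)%g (s * t)%g (rscale r f).
Proof.
move=> [lf hf] Rr; split=> [a x y|u x Nx]; last first.
  by rewrite mulgA; apply: (homogZr (x := (f x : M)) (hf u x Nx) Rr).
rewrite /rscale lf -[_ *: (f x)]/(hev (a : END M) (f x)).
rewrite [LHS](scalerDr (r : R^c) (hev (a : END M) (f x)) (f y : M)).
by rewrite -(hevZ (a : END M)).
Qed.

Fact lHOM_scale_subproof (r : R^c) (f : lHOM_type) :
  homogeneous_sums (hom_homog (fun s t => t * s)%g) (rscale r (hev f)).
Proof.
have hs := homogeneous_sums_subgroup
  (@hom_homog_subgroup G S (fun s t => t * s)%g N (left_mod M)).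
have [_ /(_ (r : R)) hr _] := grringP R.
pattern r; apply: (homogeneous_sums_ind _ _ _ hr) => {r hr}.
- rewrite (_ : rscale _ _ = 0); first exact: subgroup0.
  by apply/funext => n; apply: (scale0r (hev f n : M)).
- move=> a b Ha Hb; rewrite (_ : rscale _ _ = rscale a (hev f) + rscale b (hev f)).
    exact: subgroupD.
  by apply/funext => n; apply: (scalerDl (hev f n : M) (a : R^c) (b : R^c)).
move=> t r Rr; move: (hev f) (homsumP f) => {}f hf.
pattern f; apply: (homogeneous_sums_ind _ _ _ hf) => {f hf}.
- rewrite (_ : rscale _ _ = 0); first exact: subgroup0.
  by apply/funext => n; apply: (scaler0 M (r : R^c)).
- move=> g h Hg Hh; rewrite (_ : rscale _ _ = rscale r g + rscale r h).
    exact: subgroupD.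
  by apply/funext => n; apply: (scalerDr (r : R^c) (g n : M) (h n : M)).
- move=> s f hf; apply: homogeneous_sumsW; first exact: hom_homog_subgroup.
  exact: rscale_homog hf Rr.
Qed.

Definition lHOM_scale (r : R^c) (f : lHOM_type) : lHOM_type :=
  mk_homsum (lHOM_scale_subproof r f).

Fact lHOM_scaleA a b f : lHOM_scale a (lHOM_scale b f) = lHOM_scale (a * b) f.
Proof. by apply: homsum_inj => n; apply: (scalerA a b (hev f n : M)). Qed.
Fact lHOM_scale1 : left_id 1 lHOM_scale.
Proof. by move=> f; apply: homsum_inj => n; apply: (scale1r (hev f n : M)). Qed.
Fact lHOM_scaleDr : right_distributive lHOM_scale +%R.
Proof.
by move=> a f g; apply: homsum_inj => n; apply: (scalerDr a (hev f n : M) (hev g n : M)).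
Qed.
Fact lHOM_scaleDl f : {morph lHOM_scale^~ f : a b / a + b}.
Proof. by move=> a b; apply: homsum_inj => n; apply: (scalerDl (hev f n : M)). Qed.

HB.instance Definition _ := GRing.Zmodule_isLmodule.Build R^c lHOM_type
  lHOM_scaleA lHOM_scale1 lHOM_scaleDr lHOM_scaleDl.

Fact lHOM_grading :
  grading (@homsum_homog G _ (fun s t => t * s)%g N (left_mod M)).
Proof. by apply: homsum_grading => t; apply: mulgI. Qed.

Definition lHOM_gmod : gmod G R^c := @Gmod G R^c lHOM_type _ lHOM_grading.

Fact lHOM_subproof s t (f : lHOM_gmod) (r : R) :
  homog s f -> rhomog t r -> homog (s * t)%g ((r : R^c) *: f).
Proof.
move=> hf Rr u x Nx; rewrite mulgA.
exact: (homogZr (x := (hev (f : lHOM_type) x : M)) (hf u x Nx) Rr).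
Qed.

Definition lHOM : rgrmod R := Rgrmod lHOM_subproof.

End LeftHom.

Section Tensor.
Context (G : groupType) (R : grRing G) (M : rgrmod R) (N : rgrmod (END_gr M)).
Local Notation S := (END_gr M).
Local Notation free := {freeg (N * M)%type / int}.

Inductive tensor_rel : free -> Prop :=
| TensorDl n n' m : tensor_rel (<< (n + n', m) >> - << (n, m) >> - << (n', m) >>)
| TensorDr n m m' : tensor_rel (<< (n, m + m') >> - << (n, m) >> - << (n, m') >>)
| TensorS n (s : S) m :
    tensor_rel (<< ((s : S^c) *: n, m) >> - << (n, hev (s : END M) m) >>).

Definition tensor_sub : set free :=
  [set z | forall B : set free, subgroup B -> (forall y, tensor_rel y -> B y) -> B z].

Fact tensor_sub_subgroup : subgroup tensor_sub.
Proof.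
split=> [B sB _|x y Bx By B sB relB]; first exact: subgroup0.
by apply: subgroupB => //; [apply: Bx|apply: By].
Qed.

Definition tensor_type : Type := zquot tensor_sub_subgroup.
HB.instance Definition _ := GRing.Zmodule.on tensor_type.

Definition tensor (n : N) (m : M) : tensor_type :=
  zpi tensor_sub_subgroup << (n, m) >>.

Lemma tensorDl n n' m : tensor (n + n') m = tensor n m + tensor n' m.
Proof.
rewrite /tensor -zpiD; apply/zpi_eq; rewrite opprD addrA => B sB; apply.
exact: TensorDl.
Qed.

Lemma tensorDr n m m' : tensor n (m + m') = tensor n m + tensor n m'.
Proof.
rewrite /tensor -zpiD; apply/zpi_eq; rewrite opprD addrA => B sB; apply.
exact: TensorDr.
Qed.

Lemma tensorS n (s : S) m : tensor ((s : S^c) *: n) m = tensor n (hev (s : END M) m).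
Proof. by apply/zpi_eq => B sB; apply; apply: TensorS. Qed.

Lemma tensor0l m : tensor 0 m = 0.
Proof. by apply: (addrI (tensor 0 m)); rewrite -tensorDl !addr0. Qed.

Lemma tensor0r n : tensor n 0 = 0.
Proof. by apply: (addrI (tensor n 0)); rewrite -tensorDr !addr0. Qed.

Lemma tensorNl n m : tensor (- n) m = - tensor n m.
Proof. by apply: (addrI (tensor n m)); rewrite -tensorDl !subrr tensor0l. Qed.

Lemma tensor_suml (I : Type) (s : seq I) (F : I -> N) m :
  tensor (\sum_(i <- s) F i) m = \sum_(i <- s) tensor (F i) m.
Proof.
exact: (big_morph (tensor^~ m) (fun n n' => tensorDl n n' m) (tensor0l m)).
Qed.

Lemma tensor_sumr (I : Type) (s : seq I) (F : I -> M) n :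
  tensor n (\sum_(i <- s) F i) = \sum_(i <- s) tensor n (F i).
Proof. exact: (big_morph (tensor n) (tensorDr n) (tensor0r n)). Qed.

Lemma tensor_ind (P : tensor_type -> Prop) :
  P 0 -> (forall x y, P x -> P y -> P (x + y)) -> (forall n m, P (tensor n m)) ->
  forall x, P x.
Proof.
move=> P0 PD Pt; apply: zquotW => z; rewrite -[z]freeg_sumE.
have Psum (I : Type) (s : seq I) (F : I -> free) :
    (forall i, P (zpi tensor_sub_subgroup (F i))) ->
    P (zpi tensor_sub_subgroup (\sum_(i <- s) F i)).
  move=> PF; elim: s => [|i s IH]; first by rewrite big_nil.
  by rewrite big_cons zpiD; apply: PD.
apply: Psum => -[n m]; move: (coeff _ _) => k.
have E (e : nat) : zpi tensor_sub_subgroup << e%:Z *g (n, m) >> = tensor n m *+ e.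
  elim: e => [|e IH]; first by rewrite freegU0.
  by rewrite -addn1 PoszD -freegUD zpiD IH addn1 mulrSr.
have Pe (x : tensor_type) e : P x -> P (x *+ e).
  by move=> Px; elim: e => [|e IH]; rewrite ?mulr0n // mulrS; apply: PD.
case: k => k; first by rewrite E; apply: Pe.
by rewrite NegzE -freegUN zpiN E -mulNrn -tensorNl; apply: Pe.
Qed.

Section Lift.
Context (W : zmodType) (b : N -> M -> W).
Hypothesis bDl : forall n n' m, b (n + n') m = b n m + b n' m.
Hypothesis bDr : forall n m m', b n (m + m') = b n m + b n m'.
Hypothesis bS : forall n (s : S) m, b ((s : S^c) *: n) m = b n (hev (s : END M) m).

Definition tensor_lift_free : free -> W :=
  fglift (fun p : N * M => (b p.1 p.2 : zmodule W)).

Definition tensor_lift : tensor_type -> W := zquot_lift tensor_lift_free.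

Let lift_freeB x y : tensor_lift_free (x - y) = tensor_lift_free x - tensor_lift_free y.
Proof. exact: (lift_is_additive (fun p : N * M => (b p.1 p.2 : zmodule W)) x y). Qed.

Let lift_freeU n m : tensor_lift_free << (n, m) >> = b n m.
Proof. by rewrite /tensor_lift_free liftU scale1r. Qed.

Let lift_free_rel z : tensor_sub z -> tensor_lift_free z = 0.
Proof.
move=> /(_ [set z | tensor_lift_free z = 0]); apply.
- have e0 : tensor_lift_free 0 = 0 by have := lift_freeB 0 0; rewrite !subrr.
  by split=> // x y /= xE yE; rewrite lift_freeB xE yE subrr.
- move=> _ [n n' m|n m m'|n s m] /=; rewrite !lift_freeB !lift_freeU.
  + by rewrite bDl addrAC addrK subrr.
  + by rewrite bDr addrAC addrK subrr.
  + by rewrite bS subrr.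
Qed.

Let lift_zpi z : tensor_lift (zpi tensor_sub_subgroup z) = tensor_lift_free z.
Proof.
apply: zquot_liftE => x y /lift_free_rel; rewrite lift_freeB => /eqP.
by rewrite subr_eq0 => /eqP.
Qed.

Lemma tensor_liftE n m : tensor_lift (tensor n m) = b n m.
Proof. by rewrite lift_zpi lift_freeU. Qed.

Lemma tensor_liftD x y : tensor_lift (x + y) = tensor_lift x + tensor_lift y.
Proof.
elim/zquotW: x => x; elim/zquotW: y => y; rewrite -zpiD !lift_zpi.
have lN z : tensor_lift_free (- z) = - tensor_lift_free z.
  rewrite -[X in tensor_lift_free X]sub0r lift_freeB.
  by rewrite (lift_free_rel (subgroup0 tensor_sub_subgroup)) sub0r.
by rewrite -[X in tensor_lift_free (_ + X)]opprK lift_freeB lN opprK.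
Qed.

End Lift.

Definition tensor_scale (r : R^c) : tensor_type -> tensor_type :=
  tensor_lift (fun n m => tensor n (r *: m)).

Fact tensor_scaleE r n m : tensor_scale r (tensor n m) = tensor n (r *: m).
Proof.
apply: (tensor_liftE (b := fun n m => tensor n (r *: m)))
  => [n1 n2 x|n1 x y|n1 s x].
- exact: tensorDl.
- by rewrite scalerDr tensorDr.
- by rewrite tensorS hevZ.
Qed.

Fact tensor_scaleDr : right_distributive tensor_scale +%R.
Proof.
move=> r; apply: (tensor_liftD (b := fun n m => tensor n (r *: m)))
  => [n1 n2 x|n1 x y|n1 s x].
- exact: tensorDl.
- by rewrite scalerDr tensorDr.
- by rewrite tensorS hevZ.
Qed.

Let tensor_scale0 r : tensor_scale r 0 = 0.
Proof. by rewrite -[X in tensor_scale _ X](tensor0l 0) tensor_scaleE tensor0l. Qed.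

Fact tensor_scaleA a b x : tensor_scale a (tensor_scale b x) = tensor_scale (a * b) x.
Proof.
elim/tensor_ind: x => [|x y IHx IHy|n m]; first by rewrite !tensor_scale0.
  by rewrite !tensor_scaleDr IHx IHy.
by rewrite !tensor_scaleE scalerA.
Qed.
Fact tensor_scale1 : left_id 1 tensor_scale.
Proof.
elim/tensor_ind=> [|x y IHx IHy|n m]; first by rewrite !tensor_scale0.
  by rewrite !tensor_scaleDr IHx IHy.
by rewrite !tensor_scaleE scale1r.
Qed.
Fact tensor_scaleDl x : {morph tensor_scale^~ x : a b / a + b}.
Proof.
move=> a b; elim/tensor_ind: x => [|x y IHx IHy|n m].
- by rewrite !tensor_scale0 addr0.
- by rewrite !tensor_scaleDr IHx IHy addrACA.
- by rewrite !tensor_scaleE scalerDl tensorDr.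
Qed.

HB.instance Definition _ := GRing.Zmodule_isLmodule.Build R^c tensor_type
  tensor_scaleA tensor_scale1 tensor_scaleDr tensor_scaleDl.

Definition tensor_homog (t : G) : set tensor_type :=
  [set x | exists2 l : seq (N * M),
     forall p, p \in l -> exists s u, [/\ (s * u)%g = t, homog s p.1 & homog u p.2] &
     x = \sum_(p <- l) tensor p.1 p.2].

Fact tensor_homog_subgroup t : subgroup (tensor_homog t).
Proof.
split=> [|_ _ [l hl ->] [k hk ->]]; first by exists [::]; rewrite ?big_nil.
exists (l ++ [seq (- p.1, p.2) | p <- k]) => [p|].
  rewrite mem_cat => /orP[/hl //|/mapP[q /hk[s [u [E N1 M2]]] ->]].
  by exists s, u; split=> //; apply: (subgroupN (homog_subgroup N s)).
rewrite big_cat big_map -sumrN /=; congr (_ + _).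
by apply: eq_bigr => p _; rewrite tensorNl.
Qed.

Fact tensor_homog1 s u n m :
  homog s n -> homog u m -> tensor_homog (s * u)%g (tensor n m).
Proof.
move=> Nn Mm; exists [:: (n, m)]; last by rewrite big_seq1.
by move=> p; rewrite inE => /eqP->; exists s, u.
Qed.

Definition tensor_comp_fun (t : G) (n : N) (m : M) : tensor_type :=
  \sum_(i <- projT1 (cid (componentP (homogP N) n)))
    tensor (component (homogP N) i n) (component (homogP M) (i^-1 * t)%g m).

Fact tensor_grading : grading tensor_homog.
Proof.
have sh := tensor_homog_subgroup; split=> //.
- have hs := homogeneous_sums_subgroup sh.
  elim/tensor_ind=> [|x y Hx Hy|n m]; [exact: subgroup0|exact: subgroupD|].
  have [s [c [_ Nc ->]]] := homog_sums n; have [u [d [_ Md ->]]] := homog_sums m.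
  rewrite tensor_suml; apply: subgroup_sum => // i _.
  rewrite tensor_sumr; apply: subgroup_sum => // j _.
  by apply: homogeneous_sumsW => //; apply: tensor_homog1.
pose b t n m := tensor_comp_fun t n m.
have bE t n m (s : seq G) : uniq s ->
    (forall i, i \notin s -> component (homogP N) i n = 0) ->
    b t n m = \sum_(i <- s)
      tensor (component (homogP N) i n) (component (homogP M) (i^-1 * t)%g m).
  move=> us s0; rewrite /b /tensor_comp_fun; case: cid => r /= [[ur _ _] r0].
  rewrite -(@sum_extend _ _ r (undup (r ++ s))) ?undup_uniq //; first last.
  + by move=> i /r0->; rewrite tensor0l.
  + by move=> i ir; rewrite mem_undup mem_cat ir.
  rewrite -(@sum_extend _ _ s (undup (r ++ s))) ?undup_uniq //.
  + by move=> i ir; rewrite mem_undup mem_cat ir orbT.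
  + by move=> i /s0->; rewrite tensor0l.
have bDl t n n' m : b t (n + n') m = b t n m + b t n' m.
  have [s [[us _ _] s0]] := componentP (homogP N) n.
  have [s' [[us' _ _] s0']] := componentP (homogP N) n'.
  have ns i : i \notin undup (s ++ s') -> (i \notin s) && (i \notin s').
    by rewrite mem_undup mem_cat negb_or.
  have u2 := undup_uniq (s ++ s').
  rewrite (bE _ n _ _ u2); last by move=> i /ns/andP[/s0].
  rewrite (bE _ n' _ _ u2); last by move=> i /ns/andP[_ /s0'].
  rewrite (bE _ _ _ _ u2); last first.
    by move=> i /ns/andP[/s0 E /s0' E']; rewrite componentD E E' addr0.
  by rewrite -big_split; apply: eq_bigr => i _; rewrite componentD tensorDl.
have bDr t n m m' : b t n (m + m') = b t n m + b t n m'.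
  rewrite /b /tensor_comp_fun -big_split; apply: eq_bigr => i _.
  by rewrite componentD tensorDr.
have b1 t s n m : homog s n -> b t n m = tensor n (component (homogP M) (s^-1 * t)%g m).
  move=> Nn; rewrite (bE _ _ _ [:: s]) ?big_seq1 ?(component_id (homogP N) Nn) //.
  by move=> i; rewrite inE => /eqP is_; apply: component_out Nn is_.
have b11 t s u n m : homog s n -> homog u m ->
    b t n m = if (s * u == t)%g then tensor n m else 0.
  move=> Nn Mm; rewrite (b1 _ _ _ _ Nn); case: eqP => [<-|ne].
    by rewrite mulKg component_id.
  rewrite (component_out (homogP M) Mm) ?tensor0r // => E; apply: ne.
  by rewrite -E mulVKg.
have bS t n (s : S) m : b t ((s : S^c) *: n) m = b t n (hev (s : END M) m).
  have b0l k : b t 0 k = 0 by apply: (addrI (b t 0 k)); rewrite -bDl !addr0.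
  have b0r k : b t k 0 = 0 by apply: (addrI (b t k 0)); rewrite -bDr !addr0.
  pattern n; apply: (homogeneous_sums_ind _ _ _ (homog_sums n)) => {n}.
  + by rewrite scaler0 !b0l.
  + by move=> x y Ex Ey; rewrite scalerDr !bDl Ex Ey.
  move=> v n Nn; have [_ /(_ s) hs' _] := grringP S.
  pattern s; apply: (homogeneous_sums_ind _ _ _ hs') => {s hs'}.
  + by rewrite scale0r b0l b0r.
  + move=> x y Ex Ey; rewrite (scalerDl n (x : S^c) (y : S^c)) bDl Ex Ey.
    by rewrite -bDr.
  move=> w s Ss.
  pattern m; apply: (homogeneous_sums_ind _ _ _ (homog_sums m)) => {m}.
  + by rewrite hev0 !b0r.
  + by move=> x y Ex Ey; rewrite hevD !bDr Ex Ey.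
  move=> u m Mm.
  rewrite (b11 _ (v * w)%g u) //; last exact: homogZr.
  rewrite (b11 _ v (w * u)%g) //; last exact: Ss.
  by rewrite mulgA tensorS.
pose p t := tensor_lift (b t).
have pE t n m : p t (tensor n m) = b t n m by apply: tensor_liftE.
have pD t x y : p t (x + y) = p t x + p t y by apply: tensor_liftD.
have p0 t : p t 0 = 0 by apply: (addrI (p t 0)); rewrite -pD !addr0.
apply: (independent_proj (p := p)) => //.
- move=> t x [l hl ->]; rewrite (big_morph _ (pD t) (p0 t)).
  rewrite big_seq [RHS]big_seq; apply: eq_bigr => q /hl[s [u [E Nq Mq]]].
  by rewrite pE (b11 _ s u) // E eqxx.
- move=> t t' x [l hl ->] tt'; rewrite (big_morph _ (pD t) (p0 t)).
  rewrite big_seq big1 // => q /hl[s [u [E Nq Mq]]].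
  by rewrite pE (b11 _ s u) // E; case: eqP => // E'; case: tt'.
Qed.

Definition tensor_gmod : gmod G R^c := Gmod tensor_grading.

Fact tensor_subproof s t (x : tensor_gmod) (r : R) :
  homog s x -> rhomog t r -> homog (s * t)%g ((r : R^c) *: x).
Proof.
move=> [l hl ->] Rr; rewrite scaler_sumr.
apply: (subgroup_sum (tensor_homog_subgroup _)) => p /hl[u [v [<- Np Mp]]].
rewrite -[_ *: _]/(tensor_scale r (tensor p.1 p.2)) tensor_scaleE -mulgA.
by apply: tensor_homog1 => //; apply: homogZr.
Qed.

Definition tensor_gr : rgrmod R := Rgrmod tensor_subproof.

End Tensor.

Section Counit.
Context (G : groupType) (R : grRing G) (M X : rgrmod R).
Local Notation T := (tensor_gr (HOM_from M X)).

Definition counit_fun : T -> X :=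
  tensor_lift (fun (f : HOM_from M X) (m : M) => hev (f : rHOM M X) m).

Lemma counit_funE (f : HOM_from M X) m :
  counit_fun (tensor f m) = hev (f : rHOM M X) m.
Proof.
apply: (tensor_liftE (b := fun (f : HOM_from M X) m => hev (f : rHOM M X) m)) => //.
by move=> *; apply: hevD.
Qed.

Fact counit_funD x y : counit_fun (x + y) = counit_fun x + counit_fun y.
Proof.
apply: (tensor_liftD (b := fun (f : HOM_from M X) m => hev (f : rHOM M X) m)) => //.
by move=> *; apply: hevD.
Qed.

Fact counit_linear : linear counit_fun.
Proof.
move=> r x y; rewrite counit_funD; congr (_ + _).
have c0 : counit_fun 0 = 0 by apply: (addrI (counit_fun 0)); rewrite -counit_funD !addr0.
elim/tensor_ind: x => [|x z Ex Ez|f m]; first by rewrite scaler0 c0 scaler0.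
  by rewrite scalerDr !counit_funD Ex Ez scalerDr.
rewrite -[r *: _]/(tensor_scale r (tensor f m)) tensor_scaleE !counit_funE.
exact: hevZ.
Qed.

HB.instance Definition _ := GRing.isLinear.Build _ _ _ _ counit_fun counit_linear.

Fact counit_deg s x : homog s x -> homog s (counit_fun x).
Proof.
move=> [l hl ->].
have -> : counit_fun (\sum_(p <- l) tensor p.1 p.2) =
    \sum_(p <- l) hev (p.1 : rHOM M X) p.2.
  by rewrite raddf_sum; apply: eq_bigr => p _; exact: counit_funE.
apply: (subgroup_sum (homog_subgroup X _)) => p /hl[u [v [<- fp Mp]]].
exact: fp.
Qed.

Definition counit : ghom T X := @Ghom G _ T X (counit_fun : {linear T -> X}) counit_deg.

End Counit.

Section Evaluation.
Context (G : groupType) (R : grRing G) (M X : rgrmod R).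
Local Notation S := (END_gr M).
Local Notation D := (lHOM (HOM_to X M)).

Definition eval_at (x : X) (f : HOM_to X M) : left_mod M := hev (f : rHOM X M) x.

Fact eval_homog s x : homog s x -> hom_homog (fun s t => t * s)%g s (eval_at x).
Proof. by move=> Xx; split=> // t f hf; apply: hf. Qed.

Fact eval_subproof x : homogeneous_sums (hom_homog (fun s t => t * s)%g) (eval_at x).
Proof.
have hs := homogeneous_sums_subgroup
  (@hom_homog_subgroup G S (fun s t => t * s)%g (HOM_to X M) (left_mod M)).
pattern x; apply: (homogeneous_sums_ind _ _ _ (homog_sums x)) => {x}.
- rewrite (_ : eval_at 0 = 0); first exact: subgroup0.
  by apply/funext => f; apply: (hev0 (f : rHOM X M)).
- move=> x y Hx Hy; rewrite (_ : eval_at (x + y) = eval_at x + eval_at y).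
    exact: (subgroupD hs Hx Hy).
  by apply/funext => f; apply: (hevD (f : rHOM X M)).
- move=> s x Xx.
  exact: (homogeneous_sumsW (@hom_homog_subgroup _ _ _ _ _) (eval_homog Xx)).
Qed.

Definition eval_fun (x : X) : D := mk_homsum (eval_subproof x) : lHOM_type _.

Fact eval_linear : linear eval_fun.
Proof. by move=> r x y; apply: homsum_inj => f; apply: (hev_linear (f : rHOM X M)). Qed.

HB.instance Definition _ := GRing.isLinear.Build _ _ _ _ eval_fun eval_linear.

Fact eval_deg s x : homog s x -> homog s (eval_fun x).
Proof. by move=> Xx t f hf; apply: hf. Qed.

Definition evaluation : ghom X D := @Ghom G _ X D (eval_fun : {linear X -> D}) eval_deg.

End Evaluation.

Definition Stat (G : groupType) (R : grRing G) (M X : rgrmod R) : Prop :=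
  is_giso (counit M X).

Definition Refl (G : groupType) (R : grRing G) (M X : rgrmod R) : Prop :=
  is_giso (evaluation M X).

(* Main.v *)
Require Import Defs.
From HB Require Import structures.
From mathcomp Require Import all_boot all_algebra.
From mathcomp Require Import boolp classical_sets functions.

Set Implicit Arguments.
Unset Strict Implicit.
Unset Printing Implicit Defensive.

Import GRing.Theory.

Local Open Scope classical_set_scope.
Local Open Scope ring_scope.

(** The elements of degree 1 of S = END_R(M) are the endomorphisms of M in
    gr(R), and they are also, through left (resp. right) multiplication, the
    endomorphisms of S in the category of graded right (resp. left) modules.
    A graded submodule is a direct summand when some graded endomorphism
    projects onto it ([direct_summandP]), so all the conditions to be compared
    speak of degree 1 elements of the single ring S.

    For the first part: M is self-Rickart when each f of degree 1 has some e of
    degree 1 with f e = 0 which fixes every x in Ker f; S is self-Rickart as a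
    right module when each f has some e with f e = 0 such that e g = g for all
    g in S with f g = 0 ([rregular_rickartP]).  The first condition gives the
    second by evaluation at the elements of M.  Conversely, the g in S with
    f g = 0 are the maps of M into Ker f, so e fixes every value of every map
    from M to Ker f, and hence all of Ker f as soon as these values generate
    Ker f ([self_rickart_of_generated_ker]).

    The second part is dual: f on the left becomes f on the right, and the
    maps g with g f = 0 are those that factor through Coker f; what is needed
    is that these maps to M separate the elements of Coker f
    ([dual_self_rickart_of_cogenerated_coker]).

    Being M-cyclic, or in Stat, only enters through two implications: a retract
    of M has the property, and an object with the property is generated by M.
    When M is self-Rickart the kernels are retracts of M, so each such property
    can serve in the equivalence ([self_rickart_iff]).  Being M-cocyclic, or in
    Refl, enters likewise with cogeneration ([dual_self_rickart_iff]). *)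

(** * Graded morphisms and direct summands *)

Section GradedMorphisms.
Context (G : groupType) (A : pzRingType).
Implicit Types X Y Z : gmod G A.

Definition mk_ghom X Y (f : X -> Y) (lf : linear f)
    (hf : forall s x, homog s x -> homog s (f x)) : ghom X Y :=
  let C := GRing.isLinear.Build _ _ _ _ f lf in
  let f' : {linear X -> Y} := HB.pack f C in
  @Ghom G A X Y f' hf.

Lemma homog0 X s : @homog _ _ X s 0.
Proof. exact: (subgroup0 (homog_subgroup X s)). Qed.

Lemma homogB X s (x y : X) : homog s x -> homog s y -> homog s (x - y).
Proof. exact: (subgroupB (homog_subgroup X s)). Qed.

Lemma ghom_id_linear X : linear (@id X). Proof. by []. Qed.

Definition ghom_id X : ghom X X := mk_ghom (@ghom_id_linear X) (fun _ _ h => h).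

Lemma ghom_zero_linear X Y : linear (fun _ : X => 0 : Y).
Proof. by move=> a x y; rewrite scaler0 addr0. Qed.

Definition ghom_zero X Y : ghom X Y :=
  mk_ghom (@ghom_zero_linear X Y) (fun s _ _ => homog0 Y s).

Lemma ghom_sub_linear X Y (f g : ghom X Y) : linear (fun x => f x - g x).
Proof. by move=> a x y; rewrite (linearP f) (linearP g) scalerBr opprD addrACA. Qed.

Definition ghom_sub X Y (f g : ghom X Y) : ghom X Y :=
  mk_ghom (@ghom_sub_linear X Y f g)
    (fun s x Xx => homogB (ghomP f Xx) (ghomP g Xx)).

(** A complement of K makes the component along K well defined, hence linear;
    it preserves degrees because the homogeneous components of the two parts of
    a homogeneous x form another decomposition of x. *)
Lemma direct_summandP X (K : set X) :
  direct_summand K <->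
  exists e : ghom X X, (forall x, K (e x)) /\ (forall x, K x -> e x = x).
Proof.
split=> [[gK [L [gL KL KL0]]]|[e [Ke eK]]].
- have sK := gsubmod_subgroup gK; have sL := gsubmod_subgroup gL.
  have dec_uniq k l k' l' : K k -> L l -> K k' -> L l' -> k + l = k' + l' -> k = k'.
    move=> Kk Ll Kk' Ll' E; apply/eqP; rewrite -subr_eq0; apply/eqP/KL0.
      exact: subgroupB.
    suff -> : k - k' = l' - l by exact: subgroupB.
    by apply/eqP; rewrite subr_eq addrAC [l' + _]addrC -E addrK.
  have /choice[k kP] x : exists k, K k /\ L (x - k).
    by have [k Kk [l Ll ->]] := KL x; exists k; split; rewrite // addrC addKr.
  have k_lin : linear k.
    move=> a x y; have [Kx Lx] := kP x; have [Ky Ly] := kP y.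
    have [Kz Lz] := kP (a *: x + y).
    have [_ KZ _] := gK; have [_ LZ _] := gL.
    apply: (dec_uniq _ _ _ _ Kz Lz (KZ a _ _ Kx Ky) (LZ a _ _ Lx Ly)).
    by rewrite addrC subrK addrACA -scalerDr ![_ + (_ - _)]addrC !subrK.
  have k_homog s x : homog s x -> homog s (k x).
    move=> Xx; have [Kx Lx] := kP x.
    have -> : k x = component (homogP X) s (k x).
      apply: (dec_uniq _ _ _ _ Kx Lx (gsubmod_component gK s Kx)
        (gsubmod_component gL s Lx)).
      by rewrite -componentD addrC subrK component_id.
    exact: component_in.
  exists (mk_ghom k_lin k_homog); split=> x /=; first by case: (kP x).
  move=> Kx; have [Kkx Lx] := kP x.
  apply: (dec_uniq _ _ _ _ Kkx Lx Kx (subgroup0 sL)).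
  by rewrite addrC subrK addr0.
- have KE : K = gim e.
    apply/seteqP; split=> [x Kx|_ [x _ <-]]; last exact: Ke.
    by exists x; rewrite // eK.
  split; first by rewrite KE; apply: gim_gsubmod.
  exists (gker e); split; first exact: gker_gsubmod.
  + move=> x; exists (e x); rewrite ?Ke //; exists (x - e x).
      by rewrite /gker /= raddfB /= [e (e x)]eK ?subrr.
    by rewrite addrC subrK.
  + by move=> x Kx; rewrite /gker /= eK.
Qed.

End GradedMorphisms.

(** * The regular modules of a graded ring *)

Section UnitDegree.
Context (G : groupType) (T : grRing G).

Lemma rhomog_subgroup s : subgroup (@rhomog G T s).
Proof. by case: (grringP T). Qed.

(** Comparing the degree t components in x = x 1 = sum_i x 1_i shows that the
    component u of degree 1 of the unit satisfies x u = x for x homogeneous,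
    hence for all x, and 1 u = 1. *)
Lemma rhomog1 : rhomog 1%g (1 : T).
Proof.
pose u s : T := component (grringP T) s 1.
have [s [[us _ E1] u0]] := componentP (grringP T) 1.
have xu t (x : T) : rhomog t x -> x * u 1%g = x.
  move=> Tx; have c0 : component (grringP T) t 0 = 0.
    by rewrite component_id //; apply: (subgroup0 (rhomog_subgroup t)).
  have xuE i : component (grringP T) t (x * u i) = if i == 1%g then x * u i else 0.
    have Txu : rhomog (t * i)%g (x * u i) by apply: rhomogM => //; apply: component_in.
    case: eqP Txu => [->|ne]; first by rewrite mulg1; apply: component_id.
    move=> Txu; apply: (component_out _ Txu) => E; apply: ne.
    by apply: (mulgI t); rewrite -E mulg1.
  rewrite -[RHS](component_id (grringP T) Tx) -[x in RHS]mulr1 E1 mulr_sumr.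
  rewrite (big_morph _ (componentD _ _) c0) (eq_bigr _ (fun i _ => xuE i)).
  rewrite -big_mkcond /=; have [s1|s1] := boolP (1%g \in s).
    by rewrite -big_filter filter_pred1_uniq // big_seq1.
  rewrite (_ : u 1%g = 0) ?mulr0; last exact: u0.
  by rewrite big_seq_cond big1 // => i /andP[si /eqP i1]; rewrite -i1 si in s1.
suff <- : u 1%g = 1 by exact: component_in.
rewrite -[LHS]mul1r [X in X * _]E1 mulr_suml [RHS]E1; apply: eq_bigr => i _.
by apply: (xu i); apply: component_in.
Qed.

End UnitDegree.

Section RegularRickart.
Context (G : groupType) (T : grRing G).

Lemma homog_lmul s (f x : T) : rhomog 1%g f -> rhomog s x -> rhomog s (f * x).
Proof. by move=> f1 Tx; rewrite -[s]mul1g; apply: rhomogM. Qed.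

Lemma homog_rmul s (f x : T) : rhomog 1%g f -> rhomog s x -> rhomog s (x * f).
Proof. by move=> f1 Tx; rewrite -[s]mulg1; apply: rhomogM. Qed.

Lemma lmult_linear (f : T) :
  linear (fun x : rregular T => (f * (x : T) : T) : rregular T).
Proof.
by move=> a x y; rewrite [LHS]mulrDr; congr (_ + _); exact: (mulrA f (x : T) (a : T)).
Qed.

(** Left multiplications are the endomorphisms of the regular right module;
    they are graded when the multiplier has degree 1. *)
Definition lmult (f : T) (f1 : rhomog 1%g f) : ghom (rregular T) (rregular T) :=
  mk_ghom (@lmult_linear f) (fun s x => @homog_lmul s f x f1).

Lemma rmult_linear (f : T) :
  linear (fun x : lregular T => ((x : T) * f : T) : lregular T).
Proof.
move=> a x y; rewrite [LHS]mulrDl; congr (_ + _).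
exact: (esym (mulrA (a : T) (x : T) f)).
Qed.

Definition rmult (f : T) (f1 : rhomog 1%g f) : ghom (lregular T) (lregular T) :=
  mk_ghom (@rmult_linear f) (fun s x => @homog_rmul s f x f1).

Lemma rregular_ghomE (h : ghom (rregular T) (rregular T)) (x : T) :
  h x = (h (1 : T) : T) * x :> T.
Proof.
have E : x = (x : T^c) *: ((1 : T) : rregular T) :> rregular T by exact: esym (mul1r x).
by rewrite [in LHS]E linearZ.
Qed.

Lemma lregular_ghomE (h : ghom (lregular T) (lregular T)) (x : T) :
  h x = x * (h (1 : T) : T) :> T.
Proof.
have E : x = x *: ((1 : T) : lregular T) :> lregular T by exact: esym (mulr1 x).
by rewrite [in LHS]E linearZ.
Qed.

(** An endomorphism of the regular right module is left multiplication by its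
    value at 1, which has degree 1 because 1 does.  The element e is the value
    at 1 of a projection onto the right annihilator of f. *)
Lemma rregular_rickartP :
  self_rickart (rregular T) <->
  forall f : T, rhomog 1%g f -> exists e : T,
    [/\ rhomog 1%g e, f * e = 0 & forall g, f * g = 0 -> e * g = g].
Proof.
split=> [rT f f1|rT h].
- have /direct_summandP[e [fe eg]] := rT (lmult f1).
  exists (e (1 : T)); split; first exact: (ghomP e (rhomog1 T)).
    exact: fe.
  by move=> g fg; rewrite -rregular_ghomE; apply: eg.
- have h1 : rhomog 1%g (h (1 : T) : T) := ghomP h (rhomog1 T).
  have [e [e1 he eg]] := rT _ h1.
  apply/direct_summandP; exists (lmult e1); split=> x.
    by rewrite /gker /= rregular_ghomE mulrA he mul0r.
  by rewrite /gker /= rregular_ghomE => /eg.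
Qed.

Lemma lregular_rickartP :
  self_rickart (lregular T) <->
  forall f : T, rhomog 1%g f -> exists e : T,
    [/\ rhomog 1%g e, e * f = 0 & forall g, g * f = 0 -> g * e = g].
Proof.
split=> [rT f f1|rT h].
- have /direct_summandP[e [fe eg]] := rT (rmult f1).
  exists (e (1 : T)); split; first exact: (ghomP e (rhomog1 T)).
    exact: fe.
  by move=> g fg; rewrite -lregular_ghomE; apply: eg.
- have h1 : rhomog 1%g (h (1 : T) : T) := ghomP h (rhomog1 T).
  have [e [e1 he eg]] := rT _ h1.
  apply/direct_summandP; exists (rmult e1); split=> x.
    by rewrite /gker /= lregular_ghomE -mulrA he mulr0.
  by rewrite /gker /= lregular_ghomE => /eg.
Qed.

End RegularRickart.

(** * Morphisms as elements of HOM, kernels and cokernels *)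

Section HomOfGhom.
Context (G : groupType) (R : grRing G).

Lemma ghom_homsum (X Y : rgrmod R) (f : ghom X Y) :
  homogeneous_sums (@hom_homog G _ *%g X Y) f.
Proof.
apply: (homogeneous_sumsW (@hom_homog_subgroup _ _ _ _ _) (s := 1%g)); split.
  by move=> a x y; rewrite linearP.
by move=> t x; rewrite mul1g; apply: ghomP.
Qed.

Definition hom_of_ghom (X Y : rgrmod R) (f : ghom X Y) : rHOM X Y :=
  mk_homsum (ghom_homsum f).

Lemma hom_of_ghom_deg1 (M : rgrmod R) (f : ghom M M) :
  rhomog 1%g (hom_of_ghom f : END_gr M).
Proof. by move=> t x; rewrite mul1g; apply: ghomP. Qed.

End HomOfGhom.

Section KerCokerMaps.
Context (G : groupType) (R : grRing G).

Definition rgsub_incl (X : rgrmod R) (K : set X) (gK : gsubmod K) : ghom (rgsub gK) X :=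
  @Ghom G _ (rgsub gK) X (val : {linear gsub_type gK -> X}) (fun _ _ h => h).

Lemma rgsub_inclP (X : rgrmod R) (K : set X) (gK : gsubmod K) x : K (rgsub_incl gK x).
Proof. exact: asboolW (valP (x : gsub_type gK)). Qed.

Lemma rgsub_inclI (X : rgrmod R) (K : set X) (gK : gsubmod K) :
  injective (rgsub_incl gK).
Proof. exact: val_inj. Qed.

Definition rgsub_lift_fun (X Y : rgrmod R) (K : set X) (gK : gsubmod K)
  (f : ghom Y X) (fK : forall y, K (f y)) : Y -> rgsub gK :=
  fun y => exist _ (f y) (asboolT (fK y)).

Lemma rgsub_lift_linear (X Y : rgrmod R) (K : set X) (gK : gsubmod K)
  (f : ghom Y X) (fK : forall y, K (f y)) : linear (rgsub_lift_fun gK fK).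
Proof. by move=> a x y; apply: val_inj; rewrite /= linearP. Qed.

Definition rgsub_lift (X Y : rgrmod R) (K : set X) (gK : gsubmod K)
    (f : ghom Y X) (fK : forall y, K (f y)) : ghom Y (rgsub gK) :=
  mk_ghom (@rgsub_lift_linear _ _ _ gK f fK) (fun s y => @ghomP _ _ _ _ f s y).

Definition rgquot_proj (X : rgrmod R) (K : set X) (gK : gsubmod K) : ghom X (rgquot gK) :=
  @Ghom G _ X (rgquot gK) (gquot_pi gK : {linear X -> gquot_type gK})
    (fun s x Xx => ex_intro2 _ _ x Xx erefl).

Lemma rgquot_projW (X : rgrmod R) (K : set X) (gK : gsubmod K) (c : rgquot gK) :
  exists x, c = rgquot_proj gK x.
Proof. by elim/gquotW: c => x; exists x. Qed.

Lemma rgquot_proj_eq0 (X : rgrmod R) (K : set X) (gK : gsubmod K) x :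
  rgquot_proj gK x = 0 <-> K x.
Proof. exact: gquot_pi_eq0. Qed.

Definition rgquot_desc_fun (X Y : rgrmod R) (K : set X) (gK : gsubmod K)
  (f : ghom X Y) : rgquot gK -> Y := zquot_lift f.

Lemma rgquot_descE (X Y : rgrmod R) (K : set X) (gK : gsubmod K)
    (f : ghom X Y) (fK : forall x, K x -> f x = 0) x :
  rgquot_desc_fun f (rgquot_proj gK x) = f x.
Proof.
apply: (zquot_liftE (gsubmod_subgroup gK) (f := f)) => y z /fK.
by rewrite raddfB => /subr0_eq.
Qed.

Lemma rgquot_desc_linear (X Y : rgrmod R) (K : set X) (gK : gsubmod K)
    (f : ghom X Y) (fK : forall x, K x -> f x = 0) :
  linear (@rgquot_desc_fun _ _ _ gK f).
Proof.
move=> a c d; have [x ->] := rgquot_projW c; have [y ->] := rgquot_projW d.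
by rewrite -linearP !rgquot_descE // linearP.
Qed.

Lemma rgquot_desc_homog (X Y : rgrmod R) (K : set X) (gK : gsubmod K)
    (f : ghom X Y) (fK : forall x, K x -> f x = 0) s (c : rgquot gK) :
  homog s c -> homog s (rgquot_desc_fun f c).
Proof. by case=> x Xx <-; rewrite rgquot_descE //; apply: ghomP. Qed.

Definition rgquot_desc (X Y : rgrmod R) (K : set X) (gK : gsubmod K)
    (f : ghom X Y) (fK : forall x, K x -> f x = 0) : ghom (rgquot gK) Y :=
  mk_ghom (rgquot_desc_linear fK) (@rgquot_desc_homog _ _ _ gK f fK).

(** An epimorphism cannot tell the projection onto its cokernel from the zero
    map. *)
Lemma epi_surj (X Y : rgrmod R) (f : ghom X Y) : is_epi f -> forall y, gim f y.
Proof.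
move=> ef y; apply/(rgquot_proj_eq0 (gim_gsubmod f)).
apply: (ef (Coker f) (rgquot_proj _) (ghom_zero Y (Coker f))) => x /=.
by apply/rgquot_proj_eq0; exists x.
Qed.

(** A monomorphism cannot tell the inclusion of its kernel from the zero
    map. *)
Lemma mono_inj (X Y : rgrmod R) (f : ghom X Y) : is_mono f -> forall x, f x = 0 -> x = 0.
Proof.
move=> mf x fx.
pose k : Ker f := exist _ x (asboolT (fx : gker f x)).
apply: (mf (Ker f) (rgsub_incl (gker_gsubmod f)) (ghom_zero (Ker f) X) _ k) => z /=.
by rewrite raddf0; exact: (rgsub_inclP z).
Qed.

End KerCokerMaps.

(** * Objects generated by M, cogenerated by M, and retracts of M *)

Section Retract.
Context (G : groupType) (R : grRing G) (M : rgrmod R).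

(** The values of the maps M -> X of all degrees generate X as an additive
    group: X is its own trace of M.  This is the common consequence of
    M-cyclicity and of membership in Stat. *)
Definition generated_by (X : rgrmod R) : Prop :=
  forall P : set X, subgroup P ->
  (forall (g : rHOM M X) m, P (hev g m)) -> forall x, P x.

(** The reject of M in X vanishes: the common consequence of being M-cocyclic
    and of membership in Refl. *)
Definition cogenerated_by (X : rgrmod R) : Prop :=
  forall x : X, (forall h : rHOM X M, hev h x = 0) -> x = 0.

Definition retract_of (X : rgrmod R) : Prop :=
  exists (i : ghom X M) (p : ghom M X), cancel i p.

Lemma cyclic_generated X : cyclic_over M X -> generated_by X.
Proof.
move=> [f ef] P _ PP x; have [m _ <-] := epi_surj ef x.
exact: (PP (hom_of_ghom f)).
Qed.

(** The image of the counit is the trace of M in X. *)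
Lemma Stat_generated X : Stat M X -> generated_by X.
Proof.
move=> [g [_ gK]] P sP PP x; rewrite -[x]gK.
move: (g x) => t; elim/tensor_ind: t => [|t u Pt Pu|n m].
- by rewrite raddf0; apply: subgroup0.
- by rewrite raddfD; apply: subgroupD.
- by rewrite [counit _ _ _]counit_funE; apply: PP.
Qed.

Lemma cocyclic_cogenerated X : cocyclic_over M X -> cogenerated_by X.
Proof. by move=> [f mf] x /(_ (hom_of_ghom f)) /(mono_inj mf). Qed.

(** The kernel of the evaluation map is the reject of M in X. *)
Lemma Refl_cogenerated X : Refl M X -> cogenerated_by X.
Proof.
move=> [g [gK _]] x hx; rewrite -[x]gK (_ : evaluation M X x = 0) ?raddf0 //.
by apply: homsum_inj => h; apply: hx.
Qed.

Lemma retract_cyclic X : retract_of X -> cyclic_over M X.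
Proof. by move=> [i [p ip]]; exists p => Z g h gh x; rewrite -[x]ip; apply: gh. Qed.

Lemma retract_cocyclic X : retract_of X -> cocyclic_over M X.
Proof.
move=> [i [p ip]]; exists i => Z g h gh x; rewrite -[g x]ip -[h x]ip.
by congr (p _); apply: gh.
Qed.

(** With i : X -> M and p : M -> X such that p i = 1, the inverse of the counit
    sends x to the tensor of p and i(x): the tensor of h = p (i h) and m is that
    of p and (i h)(m), since i h lies in S and moves across the tensor sign. *)
Lemma retract_Stat X : retract_of X -> Stat M X.
Proof.
move=> [i [p ip]]; pose p' : HOM_from M X := hom_of_ghom p.
pose g (x : X) : tensor_gr (HOM_from M X) := tensor p' (i x).
have lg : linear g.
  move=> a x y; rewrite /g linearP tensorDr; congr (_ + _).
  exact: esym (tensor_scaleE _ _ _).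
have hg s x : homog s x -> homog s (g x).
  move=> Xx; rewrite -[s]mul1g; apply: tensor_homog1; last exact: ghomP.
  by move=> t m; rewrite mul1g; apply: ghomP.
exists (mk_ghom lg hg); split=> [t|x]; last first.
  by rewrite /= counit_funE; apply: ip.
rewrite /=; elim/tensor_ind: t => [|t u Et Eu|h m].
- by rewrite raddf0 /g raddf0 tensor0r.
- by rewrite raddfD /g raddfD tensorDr -/(g _) -/(g _) Et Eu.
- rewrite counit_funE /g.
  rewrite -[i _]/(hev (rHOM_comp (hom_of_ghom i) h : END M) m) -tensorS.
  by congr tensor; apply: homsum_inj => k; apply: ip.
Qed.

(** With i : X -> M and p : M -> X such that p i = 1, the inverse of the
    evaluation map sends phi to p(phi(i)).  It is an inverse because i generates
    HOM_R(X, M) over S: h = (h p) i with h p in S, so that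
    phi(h) = (h p)(phi(i)). *)
Lemma retract_Refl X : retract_of X -> Refl M X.
Proof.
move=> [i [p ip]]; pose i' : HOM_to X M := hom_of_ghom i.
pose g (phi : lHOM (HOM_to X M)) : X := p (hev (phi : lHOM_type _) i' : M).
have lg : linear g by move=> a x y; rewrite -linearP.
have hg s x : homog s x -> homog s (g x).
  move=> hx; apply: ghomP; rewrite -[s]mul1g; apply: hx.
  by move=> t m; rewrite mul1g; apply: ghomP.
exists (mk_ghom lg hg); split=> [x|phi]; first exact: ip.
apply: homsum_inj => h.
have -> : h = (rHOM_comp (h : rHOM X M) (hom_of_ghom p) : END_gr M) *: i'.
  by apply: homsum_inj => x; rewrite /= [RHS]/(hev (h : rHOM X M) (p (i x))) ip.
rewrite [RHS]hevZ.
rewrite [LHS]/(hev (h : rHOM X M) (p (i (g phi)))) ip.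
by [].
Qed.

End Retract.

(** * Self-Rickart modules *)

Section SelfRickart.
Context (G : groupType) (R : grRing G) (M : rgrmod R).
Local Notation S := (END_gr M).

Lemma self_rickart_ker_retract :
  self_rickart M -> forall f : ghom M M, retract_of M (Ker f).
Proof.
move=> rM f; have /direct_summandP[e [fe ef]] := rM f.
exists (rgsub_incl (gker_gsubmod f)), (rgsub_lift (gker_gsubmod f) fe) => x.
by apply: rgsub_inclI; exact: (ef _ (rgsub_inclP x)).
Qed.

Lemma self_rickart_END : self_rickart M -> self_rickart (rregular S).
Proof.
move=> rM; apply/rregular_rickartP => f f1.
have /direct_summandP[e [fe ef]] := rM (End0 f1).
exists (hom_of_ghom e); split; first exact: hom_of_ghom_deg1.
  by apply: homsum_inj => m; apply: fe.
move=> g fg; apply: homsum_inj => m; apply: ef.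
exact: (congr1 (fun h : END M => hev h m) fg).
Qed.

(** The elements fixed by e form a subgroup of Ker f which contains the values
    of all maps g : M -> Ker f, because f g = 0 forces e g = g. *)
Lemma self_rickart_of_generated_ker :
  self_rickart (rregular S) ->
  (forall (f : S) (f1 : rhomog 1%g f), generated_by M (Ker (End0 f1))) ->
  self_rickart M.
Proof.
move=> /rregular_rickartP rS gen f.
have f1 := hom_of_ghom_deg1 f; have [e [e1 fe eg]] := rS _ f1.
apply/direct_summandP; exists (End0 e1); split=> [m|m fm].
  exact: (congr1 (fun h : END M => hev h m) fe).
pose i := rgsub_incl (gker_gsubmod (End0 f1)).
pose k : Ker (End0 f1) := exist _ m (asboolT (fm : gker (End0 f1) m)).
apply: (gen _ f1 [set x | End0 e1 (i x) = i x] _ _ k).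
  split=> [|x y]; first by rewrite /mkset !raddf0.
  by move=> Ex Ey; rewrite /mkset !raddfB; congr (_ - _).
move=> g x; pose g' : S := rHOM_comp (hom_of_ghom i) g.
apply: (congr1 (fun h : END M => hev h x) (eg g' _)).
by apply: homsum_inj => y; apply: (rgsub_inclP (hev g y)).
Qed.

Lemma self_rickart_iff (Q : rgrmod R -> Prop) :
  (forall X, retract_of M X -> Q X) -> (forall X, Q X -> generated_by M X) ->
  self_rickart M <->
  self_rickart (rregular S) /\
  forall (f : S) (f1 : rhomog 1%g f), Q (Ker (End0 f1)).
Proof.
move=> retQ Qgen; split=> [rM|[rS QK]].
  split=> [|f f1]; first exact: self_rickart_END.
  exact: retQ (self_rickart_ker_retract rM _).
by apply: (self_rickart_of_generated_ker rS) => f f1; apply: Qgen (QK f f1).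
Qed.

End SelfRickart.

(** * Dual self-Rickart modules *)

Section DualSelfRickart.
Context (G : groupType) (R : grRing G) (M : rgrmod R).
Local Notation S := (END_gr M).

(** Here e is the projection along Im f, onto a complement: it is the form that
    matches left annihilators, as e f = 0, and it descends to an embedding of
    Coker f into M. *)
Lemma direct_summand_gimP (f : ghom M M) :
  direct_summand (gim f) <->
  exists e : ghom M M, (forall m, e (f m) = 0) /\ (forall m, gim f (m - e m)).
Proof.
split=> [/direct_summandP[e [fe ef]]|[e [ef fe]]].
  exists (ghom_sub (ghom_id M) e); split=> m /=; last by rewrite subKr; apply: fe.
  by rewrite ef ?subrr //; exists m.
apply/direct_summandP; exists (ghom_sub (ghom_id M) e); split=> [m|_ [m _ <-]] /=.
  exact: fe.
by rewrite ef subr0.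
Qed.

Lemma dual_self_rickart_coker_retract :
  dual_self_rickart M -> forall f : ghom M M, retract_of M (Coker f).
Proof.
move=> rM f; have /direct_summand_gimP[e [ef fe]] := rM f.
have e0 m : gim f m -> e m = 0 by case=> x _ <-; apply: ef.
exists (rgquot_desc (gim_gsubmod f) e0), (rgquot_proj (gim_gsubmod f)) => c.
have [m ->] := rgquot_projW c; rewrite /= rgquot_descE //.
apply/esym/eqP; rewrite -subr_eq0 -raddfB; apply/eqP/rgquot_proj_eq0; exact: fe.
Qed.

Lemma dual_self_rickart_END : dual_self_rickart M -> self_rickart (lregular S).
Proof.
move=> rM; apply/lregular_rickartP => f f1.
have /direct_summand_gimP[e [ef fe]] := rM (End0 f1).
exists (hom_of_ghom e); split; first exact: hom_of_ghom_deg1.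
  by apply: homsum_inj => m; apply: ef.
move=> g gf; apply: homsum_inj => m; have [x _ Ex] := fe m.
rewrite -[X in _ = hev _ X](subrK (e m)) hevD -Ex.
have -> : hev (g : END M) (End0 f1 x) = 0.
  exact: (congr1 (fun h : END M => hev h x) gf).
by rewrite add0r.
Qed.

(** With q : M -> Coker f the projection, each h : Coker f -> M gives h q in S
    with h q f = 0, hence h q e = h q; so h kills q(m - e m) for all m, and by
    cogeneration m - e m lies in Im f. *)
Lemma dual_self_rickart_of_cogenerated_coker :
  self_rickart (lregular S) ->
  (forall (f : S) (f1 : rhomog 1%g f), cogenerated_by M (Coker (End0 f1))) ->
  dual_self_rickart M.
Proof.
move=> /lregular_rickartP rS cogen f.
have f1 := hom_of_ghom_deg1 f; have [e [e1 ef eg]] := rS _ f1.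
apply/direct_summand_gimP; exists (End0 e1); split=> [m|m].
  exact: (congr1 (fun h : END M => hev h m) ef).
pose q := rgquot_proj (gim_gsubmod (End0 f1)).
apply/(rgquot_proj_eq0 (gim_gsubmod (End0 f1))).
apply: (cogen _ f1) => h; pose h' : S := rHOM_comp h (hom_of_ghom q).
have h'e : h' * e = h'.
  apply: eg; apply: homsum_inj => x.
  rewrite [LHS]/(hev h (q (End0 f1 x))).
  have -> : q (End0 f1 x) = 0 by apply/rgquot_proj_eq0; exists x.
  exact: hev0.
apply: (addIr (hev (h' : END M) (End0 e1 m))); rewrite add0r.
rewrite -[hev h _]/(hev (h' : END M) (m - End0 e1 m)) -hevD subrK.
exact: esym (congr1 (fun h : END M => hev h m) h'e).
Qed.

Lemma dual_self_rickart_iff (Q : rgrmod R -> Prop) :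
  (forall X, retract_of M X -> Q X) -> (forall X, Q X -> cogenerated_by M X) ->
  dual_self_rickart M <->
  self_rickart (lregular S) /\
  forall (f : S) (f1 : rhomog 1%g f), Q (Coker (End0 f1)).
Proof.
move=> retQ Qcog; split=> [rM|[rS QC]].
  split=> [|f f1]; first exact: dual_self_rickart_END.
  exact: retQ (dual_self_rickart_coker_retract rM _).
by apply: (dual_self_rickart_of_cogenerated_coker rS) => f f1; apply: Qcog (QC f f1).
Qed.

End DualSelfRickart.

Theorem corollary4p5 (G : groupType) (R : grRing G) (M : rgrmod R) :
  let S := END_gr M in
  ((self_rickart M <->
      self_rickart (rregular S) /\
      forall (f : S) (f1 : rhomog 1%g f), cyclic_over M (Ker (End0 f1))) /\
   (self_rickart M <->
      self_rickart (rregular S) /\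
      forall (f : S) (f1 : rhomog 1%g f), Stat M (Ker (End0 f1)))) /\
  ((dual_self_rickart M <->
      self_rickart (lregular S) /\
      forall (f : S) (f1 : rhomog 1%g f), cocyclic_over M (Coker (End0 f1))) /\
   (dual_self_rickart M <->
      self_rickart (lregular S) /\
      forall (f : S) (f1 : rhomog 1%g f), Refl M (Coker (End0 f1)))).
Proof.
move=> S; split; split.
- exact: (self_rickart_iff (@retract_cyclic _ _ M) (@cyclic_generated _ _ M)).
- exact: (self_rickart_iff (@retract_Stat _ _ M) (@Stat_generated _ _ M)).
- exact: (dual_self_rickart_iff (@retract_cocyclic _ _ M) (@cocyclic_cogenerated _ _ M)).
- exact: (dual_self_rickart_iff (@retract_Refl _ _ M) (@Refl_cogenerated _ _ M)).
Qed.
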